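(* For every integer $d\ge1$ there is a constant $C_d$ depending only on $d$ such that the following holds. Let $n_1,\dots,n_d\ge 1$ be integers, $n=n_1\cdots n_d$, let $\mathbf x_1,\dots,\mathbf x_n$ be an enumeration of the lattice design $\mathbb L_{n_1,\dots,n_d}$, and let $\sigma>0$. For every $f^*:[0,1]^d\to\mathbb R$, if $y_i=f^*(\mathbf x_i)+\xi_i$ with $\xi_1,\dots,\xi_n$ i.i.d. $N(0,\sigma^2)$, then the least squares estimator $$\hat f_{\mathrm{EM}}\in\operatorname*{arg\,min}_{f\in\mathcal F_{\mathrm{EM}}^d}\frac1n\sum_{i=1}^n (y_i-f(\mathbf x_i))^2$$ satisfies $$\mathcal R(\hat f_{\mathrm{EM}},f^* )\le\inf_{f\in\mathfrak R^d\cap\mathcal F^d_{\mathrm{EM}}}\left\{\mathcal L(f,f^* )+C_d\,\sigma^2\frac{k(f)}{n}(\log(en))^{\frac{3d}{2}}(\log(e\log(en)))^{\frac{2d-1}{2}}\right\}.$$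
   Context: Notation: $\mathbf a\preceq\mathbf b$ means $a_j\le b_j$ for all $j$; for $\mathbf a\preceq\mathbf b$, $[\mathbf a,\mathbf b]=\prod_j[a_j,b_j]$. Quasi-volume: for $f:[0,1]^d\to\mathbb R$ and distinct $\mathbf a\preceq\mathbf b$ in $[0,1]^d$, $$\Delta(f;[\mathbf a,\mathbf b])=\sum_{j_1=0}^{J_1}\cdots\sum_{j_d=0}^{J_d}(-1)^{j_1+\dots+j_d}f(b_1+j_1(a_1-b_1),\dots,b_d+j_d(a_d-b_d)),$$ where $J_i=1$ if $a_i\ne b_i$ and $J_i=0$ otherwise. Entire monotonicity: $\mathcal F_{\mathrm{EM}}^d$ is the class of all $f:[0,1]^d\to\mathbb R$ with $\Delta(f;[\mathbf a,\mathbf b])\ge 0$ for all $\mathbf a\ne\mathbf b$ in $[0,1]^d$ with $\mathbf a\preceq\mathbf b$. Rectangular piecewise constant functions: given $d$ univariate partitions $0=x^{(s)}_0<\dots<x^{(s)}_{k_s}=1$, $s=1,\dots,d$, the partition $\mathcal P^*$ of $[0,1]^d$ they generate consists of all sets $A_1\times\dots\times A_d$ where each $A_s$ is either $[x^{(s)}_{l_s},x^{(s)}_{l_s+1})$ for some $0\le l_s\le k_s-1$ or the singleton $\{1\}$. A function $f:[0,1]^d\to\mathbb R$ is rectangular piecewise constant if it is constant on each set of some such $\mathcal P^*$; $\mathfrak R^d$ denotes the class of all such functions. For $f\in\mathfrak R^d$, $k(f)$ is the smallest value of $k_1\cdots k_d$ for which there are $d$ univariate partitions $0=x^{(s)}_0<\dots<x^{(s)}_{k_s}=1$,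 $s=1,\dots,d$ (the $s$-th one having $k_s$ intervals), such that $f$ is constant on each set of the partition $\mathcal P^*$ of $[0,1]^d$ that they generate. Lattice design: $\mathbb L_{n_1,\dots,n_d}=\{(i_1/n_1,\dots,i_d/n_d):0\le i_j\le n_j-1,\ j=1,\dots,d\}$. Loss and risk: $\mathcal L(g,f^* )=\frac1n\sum_{i=1}^n(g(\mathbf x_i)-f^*(\mathbf x_i))^2$ and $\mathcal R(\hat f,f^* )=\mathbb E\,\mathcal L(\hat f,f^* )$. The values of $\hat f_{\mathrm{EM}}$ at the design points do not depend on the choice of minimizer. *)

(* Defs.v *)
From HB Require Import structures.
From mathcomp Require Import all_boot all_order all_algebra.
From mathcomp Require Import all_classical all_reals all_analysis.

Set Implicit Arguments.
Unset Strict Implicit.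
Unset Printing Implicit Defensive.

Import Order.TTheory GRing.Theory Num.Theory.
Import numFieldNormedType.Exports.

Local Open Scope classical_set_scope.
Local Open Scope ring_scope.

(* A function [0,1]^d -> R is represented by a total function 'rV[R]_d -> R.
   Nothing below inspects its values outside [unit_cube]. *)

Definition unit_cube (R : realType) (d : nat) : set 'rV[R]_d :=
  [set x : 'rV[R]_d | forall j, 0 <= x 0 j <= 1].

Definition preceq (R : realType) (d : nat) (a b : 'rV[R]_d) : Prop :=
  forall j, a 0 j <= b 0 j.

(* The side condition on j says j_i <= J_i, with J_i = (a_i != b_i). *)
Definition quasi_volume (R : realType) (d : nat) (f : 'rV[R]_d -> R)
    (a b : 'rV[R]_d) : R :=
  \sum_(j : {ffun 'I_d -> bool} | [forall i, j i ==> (a 0 i != b 0 i)])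
    (-1) ^+ (\sum_i j i)%N *
    f (\row_i (b 0 i + (j i)%:R * (a 0 i - b 0 i))).

Definition entirely_monotone (R : realType) (d : nat) :
    set ('rV[R]_d -> R) :=
  [set f | forall a b, unit_cube a -> unit_cube b -> a != b -> preceq a b ->
    0 <= quasi_volume f a b].

(* [itv_partition 0 1 p] says that 0 :: p is strictly increasing and ends at 1,
   so that p lists x_1 < ... < x_k = 1 without x_0 = 0, and size p = k. *)
Definition is_univ_cell (R : realType) (p : seq R) (A : set R) : Prop :=
  (exists2 l, (l < size p)%N & A = `[(0 :: p)`_l, (0 :: p)`_l.+1[%classic) \/
  A = [set 1].

Definition rect_partition (R : realType) (d : nat) (p : 'I_d -> seq R) :
    set (set 'rV[R]_d) :=
  [set B | exists2 A : 'I_d -> set R,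
    forall s, is_univ_cell (p s) (A s) & B = [set x : 'rV[R]_d | forall s, A s (x 0 s)]].

Definition constant_on_cells (R : realType) (d : nat) (p : 'I_d -> seq R)
    (f : 'rV[R]_d -> R) : Prop :=
  (forall s, itv_partition 0 1 (p s)) /\
  forall B, rect_partition p B -> forall x y, B x -> B y -> f x = f y.

Definition rect_pw_constant (R : realType) (d : nat) : set ('rV[R]_d -> R) :=
  [set f | exists p, constant_on_cells p f].

Definition cell_counts (R : realType) (d : nat) (f : 'rV[R]_d -> R) : set nat :=
  [set m | exists2 p, constant_on_cells p f & m = (\prod_s size (p s))%N].

(* k(f); the default value 0 is only taken when f is not in
   [rect_pw_constant]. *)
Definition min_cells (R : realType) (d : nat) (f : 'rV[R]_d -> R) : nat :=
  xget 0%N [set m | cell_counts f m /\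
                    forall m', cell_counts f m' -> (m <= m')%N].

Definition lattice (R : realType) (d : nat) (n : 'I_d -> nat) :
    set 'rV[R]_d :=
  [set x : 'rV[R]_d | exists2 i : 'I_d -> nat, forall j, (i j < n j)%N &
    x = \row_j ((i j)%:R / (n j)%:R)].

Definition sq_error (R : realType) (d N : nat) (x : 'I_N -> 'rV[R]_d)
    (y : 'I_N -> R) (f : 'rV[R]_d -> R) : R :=
  N%:R^-1 * \sum_(i < N) (y i - f (x i)) ^+ 2.

Definition loss (R : realType) (d N : nat) (x : 'I_N -> 'rV[R]_d)
    (g f : 'rV[R]_d -> R) : R :=
  N%:R^-1 * \sum_(i < N) (g (x i) - f (x i)) ^+ 2.

Definition argmin (R : realType) (U : Type) (F : set U) (obj : U -> R) :
    set U :=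
  [set f | F f /\ forall g, F g -> obj f <= obj g].

(* The integrand is nonnegative, so the expectation is well defined in
   [0, +oo]. *)
Definition risk (R : realType) (disp : measure_display)
    (T : measurableType disp) (P : probability T R) (d N : nat)
    (x : 'I_N -> 'rV[R]_d) (fhat : T -> 'rV[R]_d -> R)
    (f : 'rV[R]_d -> R) : \bar R :=
  'E_P[fun w => loss x (fhat w) f].

Definition mutually_independent (R : realType) (disp : measure_display)
    (T : measurableType disp) (P : probability T R) (I : finType)
    (X : I -> {RV P >-> R}) : Prop :=
  forall (J : {set I}) (A : I -> set R),
    (forall i, i \in J -> measurable (A i)) ->
    P (\bigcap_(i in [set` J]) X i @^-1` A i) =
    (\prod_(i in J) P (X i @^-1` A i))%E.

Definition iid_normal (R : realType) (disp : measure_display)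
    (T : measurableType disp) (P : probability T R) (I : finType)
    (m s : R) (X : I -> {RV P >-> R}) : Prop :=
  mutually_independent X /\
  forall i (A : set R), measurable A ->
    distribution P (X i) A = normal_prob m s A.

(* Main.v *)
Require Import Defs.
From HB Require Import structures.
From mathcomp Require Import all_boot all_order all_algebra.
From mathcomp Require Import all_classical all_reals all_analysis.
From mathcomp Require Import measurable_realfun zify ring lra.
Import Order.TTheory GRing.Theory Num.Theory.
Import numFieldNormedType.Exports.
Local Open Scope classical_set_scope.
Local Open Scope ring_scope.

(* Let [v] be the difference of the estimator and a competitor [f] at the
   design points. Convexity gives
     loss fhat f* <= loss f f* + (2 <xi, v> - |v|^2) / N,
   so it suffices to bound E sup_v (2 <xi, v> - |v|^2). No metric entropy is
   needed. Cut every coordinate range of every cell of [f] dyadically from both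
   ends; this yields at most k(f) (C log (e N))^d blocks. On a cell [v] is
   entirely monotone up to a constant, hence on a block [b] with corners [l], [r]
   it is v(l) plus a nonnegative combination, of total weight v(r) - v(l), of
   indicators of upper orthants; therefore
     |<xi, v>_b| <= (|v(l)| + v(r) - v(l)) max_j |sum_(i in b, i >= j) xi_i|.
   By monotonicity v(r)^+ is at most |v| on a set of points above [b], and v(l)^-
   is at most |v| on a set below [b]; these sets have size at least |b| / 2^d and
   overlap at most 2^d times, which makes the weights square summable against
   |v|^2. What remains is a multiparameter maximal inequality
     E max_j |sum_(i in b, i >= j) xi_i|^2 <= C |b| sigma^2,
   proved by averaging over random signs. The resulting power (log (e N))^d is
   smaller than the stated one. *)

Set Implicit Arguments.
Unset Strict Implicit.
Unset Printing Implicit Defensive.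

(** * Maximal inequality for random signs *)

(** Sums over all sign vectors [e] replace probability with uniform signs. Flipping the signs in [h]
    preserves such a sum and takes the place of conditioning on the other signs. *)
Definition flip_signs (I : finType) (h : pred I) (e : {ffun I -> bool}) :
  {ffun I -> bool} := [ffun i => e i (+) h i].

Definition signed_sum (R : realType) (I : finType) (A : pred I)
    (e : {ffun I -> bool}) (x : I -> R) : R :=
  \sum_(i | A i) (-1) ^+ e i * x i.

Lemma flip_signsK (I : finType) (h : pred I) : involutive (flip_signs h).
Proof. by move=> e; apply/ffunP => i; rewrite !ffunE addbK. Qed.

Lemma sum_flip_signs (R : realType) (I : finType) (h : pred I)
    (F : {ffun I -> bool} -> R) :
  \sum_e F (flip_signs h e) = \sum_e F e.
Proof. by rewrite [RHS](reindex_inj (inv_inj (flip_signsK h))). Qed.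

Lemma sum_signed_sum_sqr (R : realType) (I : finType) (A : pred I)
    (x : I -> R) :
  \sum_e signed_sum A e x ^+ 2 =
  #|{ffun I -> bool}|%:R * \sum_(i | A i) x i ^+ 2.
Proof.
under eq_bigr => e _.
  rewrite expr2 {1}/signed_sum mulr_suml.
  under eq_bigr => i _ do rewrite mulr_sumr.
  over.
rewrite exchange_big mulr_sumr; apply: eq_bigr => i Ai /=.
rewrite exchange_big /= (bigD1 i) //= [X in _ + X]big1 ?addr0.
  under eq_bigr => e _.
    rewrite (_ : _ * _ = x i ^+ 2); first over.
    by rewrite mulrACA -expr2 sqrr_sign mul1r expr2.
  by rewrite sumr_const mulr_natl.
move=> j /andP[Aj ji].
(* Flipping the sign of [i] alone negates each off-diagonal term, so the signs are orthogonal. *)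
set S := \sum_e _; suff : S = - S by move=> H; lra.
rewrite {1}/S -(sum_flip_signs (pred1 i)) /S -sumrN; apply: eq_bigr => e _.
by rewrite !ffunE /= eqxx (negbTE ji) addbT addbF; case: (e i) => /=;
  rewrite ?expr0 ?expr1; ring.
Qed.

(* The running maximum [M] of [N] only increases at times when it equals [N]. *)
Lemma maximal_sqr_le (R : realType) (M N : nat -> R) (n : nat) :
  M 0%N = 0 -> (forall t, M t.+1 = Num.max (M t) (N t.+1)) ->
  M n ^+ 2 <= 2 * \sum_(t < n) (M t.+1 - M t) * N t.+1.
Proof.
move=> M0 MS.
elim: n => [|n IH]; first by rewrite big_ord0 M0 mulr0 expr0n.
have Mge0 t : 0 <= M t.
  by elim: t => [|t IHt]; rewrite ?M0 // MS le_max IHt.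
rewrite big_ord_recr /= mulrDr.
apply: le_trans (lerD IH (lexx _)).
rewrite {IH} MS; case: (lerP (M n) (N n.+1)) => h.
  by have := Mge0 n; nra.
by rewrite subrr mul0r mulr0 addr0.
Qed.

Section SignMaximal.
Variables (R : realType) (I K : finType) (A : K -> pred I) (c : I -> nat).
Variable x : I -> R.

(** [c i] is the time at which the sign of [i] is revealed: [N t] depends only on the signs revealed
    before [t], and [M] is its running maximum. *)
Let N (t : nat) (e : {ffun I -> bool}) : R :=
  \big[Num.max/0]_(k : K)
    `|signed_sum (fun i => A k i && (c i < t)%N) e x|.

Let M (t : nat) (e : {ffun I -> bool}) : R :=
  \big[Num.max/0]_(u < t.+1) N u e.

Let N0 e : N 0 e = 0.
Proof.
apply/le_anti; rewrite bigmax_ge_id andbT; apply: bigmax_le => // k _.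
by rewrite /signed_sum big1 ?normr0 // => i; rewrite ltn0 andbF.
Qed.

Let M0 e : M 0 e = 0.
Proof. by rewrite /M big_ord_recl big_ord0 N0 maxxx. Qed.

Let MS t e : M t.+1 e = Num.max (M t e) (N t.+1 e).
Proof.
apply/le_anti/andP; split.
  apply: bigmax_le => [|u _]; first by rewrite le_max bigmax_ge_id.
  have [ut|] := ltnP u t.+1; last first.
    move=> tu; have -> : u = t.+1 :> nat by have := ltn_ord u; lia.
    by rewrite le_max lexx orbT.
  by rewrite le_max (le_bigmax _ (fun v : 'I_t.+1 => N v e) (Ordinal ut)).
rewrite ge_max (le_bigmax _ (fun v : 'I_t.+2 => N v e) ord_max) andbT.
apply: bigmax_le => [|u _]; first exact: bigmax_ge_id.
have ut : (u < t.+2)%N by have := ltn_ord u; lia.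
exact: (le_bigmax _ (fun v : 'I_t.+2 => N v e) (Ordinal ut)).
Qed.

Let N_flip t e (h : pred I) : (forall i, (c i < t)%N -> h i = false) ->
  N t (flip_signs h e) = N t e.
Proof.
move=> hc; apply: eq_bigr => k _; congr `|_|; apply: eq_bigr => i /andP[_ ci].
by rewrite ffunE (hc i ci) addbF.
Qed.

(** Submartingale property in pathwise form: adding a full sum to its flipped copy doubles the terms
    with [c i < t] and cancels the others. *)
Let N_half t n e : (forall i, (c i < n)%N) ->
  2 * N t e <= N n e + N n (flip_signs (fun i => (t <= c i)%N) e).
Proof.
move=> cn; set h := fun i => _.
rewrite -ler_pdivlMl //; apply: bigmax_le => [|k _].
  rewrite mulr_ge0 ?invr_ge0 // addr_ge0 //; exact: bigmax_ge_id.
rewrite ler_pdivlMl //.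
set T := signed_sum _ _ _.
have -> : 2 * `|T| = `|signed_sum (fun i => A k i && (c i < n)%N) e x +
   signed_sum (fun i => A k i && (c i < n)%N) (flip_signs h e) x|.
  rewrite -{1}[2]ger0_norm // -normrM; congr `|_|.
  rewrite /signed_sum -big_split /= /T /signed_sum mulr_sumr big_mkcondr /=.
  rewrite [RHS](eq_bigl (A k)); last by move=> i; rewrite cn andbT.
  apply: eq_bigr => i _; rewrite ffunE /h ltnNge.
  by case: (e i); case: (t <= c i)%N => /=; rewrite ?expr0 ?expr1; ring.
apply: le_trans (ler_normD _ _) _; apply: lerD; exact: le_bigmax.
Qed.

(* Doob's argument: flipping the signs with [t <= c i] leaves the increments of
   [M] up to time [t] unchanged, and averaging a point with its flip dominates
   [N t] by [N n]. *)
Lemma sign_maximal_ineq (n : nat) : (forall i, (c i < n)%N) ->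
  \sum_e (\big[Num.max/0]_(k : K) \big[Num.max/0]_(t < n.+1)
      `|signed_sum (fun i => A k i && (c i < t)%N) e x|) ^+ 2 <=
  4 * \sum_e (\big[Num.max/0]_(k : K) `|signed_sum (A k) e x|) ^+ 2.
Proof.
move=> cn.
have -> : \sum_e (\big[Num.max/0]_(k : K) `|signed_sum (A k) e x|) ^+ 2 =
    \sum_e N n e ^+ 2.
  apply: eq_bigr => e _; congr (_ ^+ 2); apply: eq_bigr => k _; congr `|_|.
  by apply: eq_bigl => i; rewrite cn andbT.
have -> : \sum_e (\big[Num.max/0]_(k : K) \big[Num.max/0]_(t < n.+1)
      `|signed_sum (fun i => A k i && (c i < t)%N) e x|) ^+ 2 =
    \sum_e M n e ^+ 2.
  apply: eq_bigr => e _; congr (_ ^+ 2); rewrite exchange_big_idem //.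
  exact: maxxx.
have step t : (t < n)%N -> \sum_e (M t.+1 e - M t e) * N t.+1 e <=
   \sum_e (M t.+1 e - M t e) * N n e.
  move=> tn; pose h i := (t < c i)%N.
  have Mh u e : (u <= t.+1)%N -> M u (flip_signs h e) = M u e.
    move=> ut; apply: eq_bigr => i _; apply: N_flip => j ji.
    rewrite /h; apply/negbTE; rewrite -leqNgt; have := ltn_ord i; lia.
  have Mmon e : 0 <= M t.+1 e - M t e by rewrite subr_ge0 MS le_max lexx.
  suff : \sum_e 2 * ((M t.+1 e - M t e) * N t.+1 e) <=
     \sum_e (M t.+1 e - M t e) * N n e +
     \sum_e (M t.+1 (flip_signs h e) - M t (flip_signs h e)) *
             N n (flip_signs h e).
    rewrite (sum_flip_signs h (fun e => (M t.+1 e - M t e) * N n e)).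
    by rewrite -mulr_sumr; lra.
  rewrite -big_split /=; apply: ler_sum => e _.
  rewrite !Mh //.
  rewrite -mulrDr mulrCA ler_wpM2l //; exact: N_half.
(* Once [step] has replaced every [N t.+1] by [N n], the increments of [M] telescope to [M n]. *)
have : \sum_e M n e ^+ 2 <= \sum_e (2 * (M n e * N n e)).
  rewrite -mulr_sumr.
  apply: le_trans (ler_sum _ (fun e _ =>
    @maximal_sqr_le R (fun t => M t e) (fun t => N t e) n (M0 e)
     (fun t => MS t e))) _.
  rewrite -mulr_sumr ler_wpM2l // exchange_big /=.
  apply: le_trans (ler_sum _ (fun (t : 'I_n) _ => step t (ltn_ord t))) _.
  rewrite exchange_big /=; apply: ler_sum => e _; rewrite -mulr_suml.
  rewrite -(big_mkord predT (fun t => M t.+1 e - M t e)).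
  by rewrite telescope_sumr // M0 subr0.
(* The weights 1/2 and 2 let half of the [M] term be absorbed on the left, which leaves the factor
   4. *)
have : \sum_e (2 * (M n e * N n e)) <=
    \sum_e (M n e ^+ 2 / 2 + 2 * N n e ^+ 2).
  apply: ler_sum => e _; move: (M n e) (N n e) => a b.
  by have := sqr_ge0 (a - 2 * b); rewrite !expr2 => h; nra.
rewrite big_split /= -mulr_suml -!mulr_sumr.
move: (\sum_e M n e ^+ 2) (\sum_e N n e ^+ 2) (\sum_e _) => a b m h1 h2.
by lra.
Qed.

End SignMaximal.

(** Induction on the number [r] of coordinates in which the threshold is active. Each new coordinate
    is treated as time in [sign_maximal_ineq], the earlier ones being part of the family [A r], at
    the cost of a factor 4; with no active threshold the second moment is exact. *)
Lemma multiparameter_maximal_ineq (R : realType) (I : finType) (d m : nat)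
    (q : I -> 'I_d -> 'I_m) (B : pred I) (x : I -> R) :
  \sum_e (\big[Num.max/0]_(j : {ffun 'I_d -> 'I_m})
    `|signed_sum (fun i => B i && [forall s, (j s <= q i s)%N]) e x|) ^+ 2
  <= 4 ^+ d * (#|{ffun I -> bool}|%:R * \sum_(i | B i) x i ^+ 2).
Proof.
pose A r (j : {ffun 'I_d -> 'I_m}) : pred I :=
  fun i => B i && [forall s : 'I_d, (s < r)%N ==> (j s <= q i s)%N].
have H r : (r <= d)%N ->
  \sum_e (\big[Num.max/0]_(j : {ffun 'I_d -> 'I_m})
    `|signed_sum (A r j) e x|) ^+ 2
  <= 4 ^+ r * (#|{ffun I -> bool}|%:R * \sum_(i | B i) x i ^+ 2).
  elim: r => [_|r IH rd].
    rewrite mul1r -sum_signed_sum_sqr; apply: ler_sum => e _.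
    rewrite -[leRHS]real_normK ?num_real //.
    rewrite lerXn2r ?nnegrE ?normr_ge0 ?bigmax_ge_id //.
    apply: bigmax_le => [|j _]; first exact: normr_ge0.
    rewrite le_eqVlt; apply/orP; left; apply/eqP; congr `|_|.
    apply: eq_bigl => i; rewrite /A; case: (B i) => //=.
    by apply/forallP => s.
  rewrite exprS -mulrA.
  apply: le_trans (ler_wpM2l _ (IH (ltnW rd))) => //.
  pose s0 := Ordinal rd.
  (* Time runs backwards along [s0], so that the upper set [j s0 <= q i s0] becomes the initial
     segment [c i < m - j s0]. *)
  pose c i := (m.-1 - q i s0)%N.
  have cm i : (c i < m)%N by rewrite /c; have := ltn_ord (q i s0); lia.
  apply: le_trans (sign_maximal_ineq (A r) x cm).
  apply: ler_sum => e _.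
  rewrite lerXn2r ?nnegrE ?bigmax_ge_id //.
  apply: bigmax_le => [|j _]; first exact: bigmax_ge_id.
  have tm : (m - j s0 < m.+1)%N by lia.
  apply: le_trans (le_bigmax _ _ j).
  apply: le_trans (le_bigmax _ _ (Ordinal tm)).
  rewrite le_eqVlt; apply/orP; left; apply/eqP; congr `|_|.
  apply: eq_bigl => i; rewrite /A -andbA; case: (B i) => //=.
  have -> : (c i < m - j s0)%N = (j s0 <= q i s0)%N.
    by rewrite /c; have := ltn_ord (q i s0); have := ltn_ord (j s0); lia.
  apply/forallP/andP => [h|[/forallP h h0] s].
    split; last by have := h s0; rewrite /= ltnSn.
    by apply/forallP => s; apply/implyP => sr; have := h s; rewrite (leqW sr).
  apply/implyP; rewrite ltnS leq_eqVlt => /orP[/eqP sr|sr].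
    by have -> : s = s0 by exact: val_inj.
  by have := h s; rewrite sr.
apply: le_trans (H d (leqnn d)); apply: ler_sum => e _.
rewrite le_eqVlt; apply/orP; left; apply/eqP; congr (_ ^+ 2).
apply: eq_bigr => j _; congr `|_|; apply: eq_bigl => i; congr (_ && _).
by apply: eq_forallb => s; rewrite ltn_ord.
Qed.

(** * Gaussian noise *)

(* No measurability: the estimator is not assumed to depend measurably on the
   sample point. *)
Lemma ge0_le_integral_pointwise (R : realType) (disp : measure_display)
    (T : measurableType disp) (mu : {measure set T -> \bar R})
    (f g : T -> \bar R) :
  (forall x, 0 <= f x)%E -> (forall x, f x <= g x)%E ->
  (\int[mu]_x f x <= \int[mu]_x g x)%E.
Proof.
move=> f0 fg; have g0 x : (0 <= g x)%E by exact: le_trans (f0 x) (fg x).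
rewrite !ge0_integralTE //; apply: ub_ereal_sup => _ [h hf <-].
by apply: ereal_sup_ubound; exists h => // x; apply: le_trans (hf x) (fg x).
Qed.

Import HBNNSimple.

(** The integral against [nu] is a supremum over simple functions [h] below [f]; for each [h] the
    change of density is exact by linearity, and [h * g] lies below [f * g]. *)
Lemma ge0_integral_density_le (R : realType) (disp : measure_display)
    (T : measurableType disp) (mu nu : {measure set T -> \bar R})
    (f g : T -> R) :
  measurable_fun setT g -> (forall x, 0 <= g x) ->
  (forall A, measurable A -> nu A = \int[mu]_(x in A) (g x)%:E)%E ->
  (forall x, 0 <= f x) ->
  (\int[nu]_x (f x)%:E <= \int[mu]_x (f x * g x)%:E)%E.
Proof.
move=> mg g0 nuE f0; rewrite ge0_integralTE //; apply: ub_ereal_sup => _ [h hf <-].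
have -> : sintegral nu h = (\int[mu]_x (h x * g x)%:E)%E.
  rewrite sintegralE.
  under [RHS]eq_integral => x _.
    rewrite fimfunE EFinM -fsumEFin // ge0_mule_fsuml; last first.
      by move=> r; rewrite EFinM nnfun_muleindic_ge0.
    over.
  rewrite ge0_integral_fsum //; last 2 first.
  - move=> r; apply: emeasurable_funM; last exact/measurable_EFinP.
    exact/measurable_EFinP/measurableT_comp.
  - move=> r x _; apply: mule_ge0; last by rewrite lee_fin.
    by rewrite EFinM nnfun_muleindic_ge0.
  apply: eq_fsbigr => r /set_mem [t _ <-].
  rewrite nuE //; under [RHS]eq_integral do rewrite EFinM -muleA.
  rewrite ge0_integralZl //; last 3 first.
  - apply: emeasurable_funM; last exact/measurable_EFinP.
    exact/measurable_EFinP.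
  - by move=> x _; rewrite mule_ge0 ?lee_fin.
  - by rewrite lee_fin.
  congr (_ * _)%E.
  rewrite [LHS]integral_mkcond; apply: eq_integral => x _.
  by rewrite epatch_indic /= muleC.
apply: ge0_le_integral_pointwise => x; first by rewrite lee_fin mulr_ge0.
by rewrite lee_fin ler_wpM2r // -lee_fin hf.
Qed.

(** The centred density is even and Lebesgue measure is invariant under reflection. *)
Lemma normal_prob_oppr (R : realType) (s : R) (A : set R) :
  s != 0 -> measurable A ->
  normal_prob 0 s (-%R @^-1` A) = normal_prob 0 s A.
Proof.
move=> s0 mA; rewrite /normal_prob.
have mN : measurable_fun setT (-%R : measurableTypeR R -> measurableTypeR R).
  exact: oppr_measurable.
transitivity (\int[pushforward lebesgue_measure
    (-%R : measurableTypeR R -> measurableTypeR R)]_(x in A)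
    (normal_pdf 0 s x)%:E)%E; last first.
  by apply: eq_measure_integral => B mB _; exact: lebesgue_measureN.
rewrite ge0_integral_pushforward //.
  by apply: eq_integral => x _ /=; rewrite normal_pdfE // /normal_fun !subr0 sqrrN.
- apply/measurable_EFinP; apply: measurable_funS (measurable_normal_pdf 0 s) => //.
- by move=> x _; rewrite lee_fin normal_pdf_ge0.
Qed.

Lemma sqr_normal_pdf_le (R : realType) (s x : R) : 0 < s ->
  x ^+ 2 * normal_pdf 0 s x <= 8 * s ^+ 2 * normal_pdf 0 (2 * s) x.
Proof.
move=> s0; have s20 : 0 < 2 * s by rewrite mulr_gt0.
rewrite !normal_pdfE ?gt_eqF // /normal_fun subr0.
have -> : normal_peak (2 * s) = normal_peak s / 2.
  rewrite /normal_peak exprMn -mulrA -mulrnAr sqrtrM ?exprn_ge0 //.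
  by rewrite sqrtr_sqr ger0_norm // invfM mulrC.
have -> : 8 * s ^+ 2 * (normal_peak s / 2 * expR (- x ^+ 2 / ((2 * s) ^+ 2 *+ 2)))
  = normal_peak s * (4 * s ^+ 2 * expR (- x ^+ 2 / ((2 * s) ^+ 2 *+ 2))).
  by field.
rewrite mulrCA ler_wpM2l ?normal_peak_ge0 //.
(* Doubling [s] halves the peak. In terms of [u] the claim is
   [u * expR (- (2 * u)) <= expR (- (u / 2))], which follows from
   [u <= 1 + 3 / 2 * u <= expR (3 / 2 * u)]. *)
pose u := x ^+ 2 / (4 * s ^+ 2).
have u0 : 0 <= u by rewrite divr_ge0 ?sqr_ge0 // mulr_ge0 // sqr_ge0.
have xu : x ^+ 2 = 4 * s ^+ 2 * u.
  by rewrite /u mulrC divfK // mulf_neq0 // sqrf_eq0 gt_eqF.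
rewrite [leLHS](_ : _ = 4 * s ^+ 2 * (u * expR (- (2 * u)))); last first.
  rewrite {1}xu -[LHS]mulrA; congr (_ * (_ * expR _)).
  by rewrite /u; field; rewrite gt_eqF.
rewrite [leRHS](_ : _ = 4 * s ^+ 2 * expR (- (u / 2))); last first.
  by congr (_ * expR _); rewrite /u; field; rewrite gt_eqF.
rewrite ler_wpM2l ?mulr_ge0 ?sqr_ge0 ?(ltW s0) //.
have -> : - (2 * u) = - (u / 2) - 3 / 2 * u by field.
rewrite expRD mulrCA -[leRHS]mulr1 ler_wpM2l ?expR_ge0 //.
rewrite expRN ler_pdivrMr ?expR_gt0 // mul1r.
by apply: le_trans (expR_ge1Dx _); lra.
Qed.

(* A crude constant suffices; the density times [x ^+ 2] is compared with the
   density of twice the standard deviation. *)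
Lemma normal_second_moment_le (R : realType) (s : R) : 0 < s ->
  (\int[normal_prob 0 s]_x (x ^+ 2)%:E <= (8 * s ^+ 2)%:E)%E.
Proof.
move=> s0.
apply: le_trans (@ge0_integral_density_le _ _ _ lebesgue_measure _ _
  (normal_pdf 0 s) _ _ _ _) _ => //.
- exact: measurable_normal_pdf.
- by move=> x; exact: normal_pdf_ge0.
- by move=> x; exact: sqr_ge0.
apply: (@le_trans _ _ (\int[lebesgue_measure]_x
    ((8 * s ^+ 2)%:E * (normal_pdf 0 (2 * s) x)%:E))%E).
  apply: ge0_le_integral_pointwise => x; last first.
    by rewrite -EFinM lee_fin sqr_normal_pdf_le.
  by rewrite lee_fin mulr_ge0 ?sqr_ge0 ?normal_pdf_ge0.
rewrite ge0_integralZl //.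
- by rewrite integral_normal_pdf mule1 lexx.
- by apply/measurable_EFinP; exact: measurable_normal_pdf.
- by move=> x _; rewrite lee_fin normal_pdf_ge0.
- by rewrite lee_fin mulr_ge0 ?sqr_ge0.
Qed.

(** * Joint laws and their determination by boxes *)

(** Boxes are stable under intersection, unlike the cylinders that define the product sigma-algebra;
    generation by boxes is what uniqueness of measures requires. *)
Lemma g_sigma_algebra_boxes (R : realType) (N : nat) :
  @measurable _ (N.-tuple R) =
  <<s [set B | exists2 A : 'I_N -> set R,
      forall i, measurable (A i) & B = [set t | forall i, A i (tnth t i)]] >>.
Proof.
apply/seteqP; split.
  apply: smallest_sub; first exact: smallest_sigma_algebra.
  move=> B; rewrite -bigcup_seq /= => -[i _ [C mC <-]].
  apply: sub_sigma_algebra; exists (fun j => if j == i then C else setT).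
    by move=> j; case: ifP.
  rewrite setTI; apply/seteqP; split => [t Ct j|t /(_ i)]; last by rewrite eqxx.
  by case: ifP => // /eqP ->.
apply: smallest_sub; first exact: sigma_algebra_measurable.
move=> _ [A mA ->].
rewrite (_ : [set _ | _] = \bigcap_(i in [set: 'I_N])
    ((fun t => tnth t i) @^-1` A i)); last first.
  by apply/seteqP; split => [t h i _|t h i]; apply: h.
apply: fin_bigcap_measurable => // i _.
by rewrite -[X in measurable X]setTI; exact: measurable_tnth.
Qed.

(** Both integrals are taken against image laws on tuples, and two finite measures that agree on the
    boxes, a generating pi-system, are equal. *)
Lemma eq_joint_law_integral (R : realType) (disp : measure_display)
    (T : measurableType disp) (P : probability T R) (N : nat)
    (X Y : 'I_N -> T -> R) (F : N.-tuple R -> \bar R) :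
  (forall i, measurable_fun setT (X i)) ->
  (forall i, measurable_fun setT (Y i)) ->
  (forall A : 'I_N -> set R, (forall i, measurable (A i)) ->
    P [set w | forall i, A i (X i w)] = P [set w | forall i, A i (Y i w)]) ->
  measurable_fun setT F -> (forall t, 0 <= F t)%E ->
  (\int[P]_w F [tuple X i w | i < N] = \int[P]_w F [tuple Y i w | i < N])%E.
Proof.
move=> mX mY XY mF F0.
have mtuple (Z : 'I_N -> T -> R) : (forall i, measurable_fun setT (Z i)) ->
    measurable_fun setT (fun w => [tuple Z i w | i < N]).
  move=> mZ; apply/measurable_fun_tnthP => i.
  rewrite (_ : _ \o _ = Z i) //.
  by apply/boolp.funext => w /=; rewrite tnth_mktuple.
pose pX := isMeasurableFun.Build _ _ _ _ _ (mtuple X mX).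
pose pY := isMeasurableFun.Build _ _ _ _ _ (mtuple Y mY).
pose X' : {mfun T >-> N.-tuple R} := HB.pack (fun w => [tuple X i w | i < N]) pX.
pose Y' : {mfun T >-> N.-tuple R} := HB.pack (fun w => [tuple Y i w | i < N]) pY.
rewrite -(ge0_integral_distribution (P := P) X' mF F0).
rewrite -(ge0_integral_distribution (P := P) Y' mF F0).
apply: eq_measure_integral => D mD _.
apply: (measure_unique _ (fun=> setT) (g_sigma_algebra_boxes R N)) => //.
- move=> _ _ [A mA ->] [B mB ->]; exists (fun i => A i `&` B i).
    by move=> i; exact: measurableI.
  apply/seteqP; split => [t [hA hB] i|t h]; first by split.
  by split => i; case: (h i).
- by move=> _; exists (fun=> setT) => //; apply/seteqP; split.
- by rewrite bigcup_const.
- move=> _ [A mA ->]; rewrite /distribution /pushforward /=.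
  have E (Z : 'I_N -> T -> R) : (fun w => [tuple Z i w | i < N]) @^-1`
      [set t | forall i, A i (tnth t i)] = [set w | forall i, A i (Z i w)].
    by apply/seteqP; split => w h i; have := h i; rewrite /= tnth_mktuple.
  by have := XY A mA; rewrite -(E X) -(E Y).
- by move=> _; apply: le_lt_trans (probability_le1 _ _) (ltry _).
Qed.

Lemma measurable_bigmax (R : realType) (disp : measure_display)
    (T : measurableType disp) (K : finType) (f : K -> T -> R) :
  (forall k, measurable_fun setT (f k)) ->
  measurable_fun setT (fun w => \big[Num.max/0]_k f k w).
Proof.
move=> mf; elim: (index_enum K) => [|k s IH].
  rewrite (_ : (fun w => _) = cst 0); first exact: measurable_cst.
  by apply/boolp.funext => w; rewrite big_nil.
rewrite (_ : (fun w => _) = f k \max (fun w => \big[Num.max/0]_(j <- s) f j w)).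
  exact: measurable_maxr.
by apply/boolp.funext => w; rewrite big_cons.
Qed.

Lemma measurable_sum_cond (R : realType) (disp : measure_display)
    (T : measurableType disp) (K : finType) (A : pred K) (f : K -> T -> R) :
  (forall k, measurable_fun setT (f k)) ->
  measurable_fun setT (fun w => \sum_(k | A k) f k w).
Proof.
move=> mf.
rewrite (_ : (fun w => _) = fun w => \sum_k (if A k then f k w else 0)).
  by apply: measurable_sum => k; case: (A k) => //; exact: measurable_cst.
by apply/boolp.funext => w; rewrite big_mkcond.
Qed.

(** * Expected maxima of Gaussian orthant sums *)

Section GaussianMaximal.
Variables (R : realType) (disp : measure_display) (T : measurableType disp).
Variables (P : probability T R) (N : nat) (sigma : R).
Variable xi : 'I_N -> {RV P >-> R}.
Hypotheses (sigma_gt0 : 0 < sigma) (hxi : iid_normal 0 sigma xi).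

(** By independence both sides are products of marginal probabilities, and each marginal is
    symmetric. *)
Lemma iid_normal_sign_symmetric (e : {ffun 'I_N -> bool}) (A : 'I_N -> set R) :
  (forall i, measurable (A i)) ->
  P [set w | forall i, A i ((-1) ^+ e i * xi i w)] =
  P [set w | forall i, A i (xi i w)].
Proof.
case: hxi => indep law mA.
have box (B : 'I_N -> set R) : (forall i, measurable (B i)) ->
    P [set w | forall i, B i (xi i w)] = (\prod_i normal_prob 0 sigma (B i))%E.
  move=> mB; have := indep [set: 'I_N]%SET B (fun i _ => mB i).
  rewrite (_ : \bigcap_(i in _) _ = [set w | forall i, B i (xi i w)]).
    move=> ->; apply: eq_big => i; rewrite ?inE // => _.
    exact: law.
  apply/seteqP; split => [w h i|w h i _]; last exact: h.
  by apply: h; rewrite /= inE.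
pose B i := if e i then -%R @^-1` A i else A i.
have mB i : measurable (B i).
  rewrite /B; case: (e i) => //.
  by rewrite -[X in measurable X]setTI; exact: oppr_measurable.
rewrite (_ : [set w | _] = [set w | forall i, B i (xi i w)]).
  rewrite !box //; apply: eq_bigr => i _; rewrite /B; case: (e i) => //.
  by rewrite normal_prob_oppr // gt_eqF.
by apply/seteqP; split => w h i; have := h i; rewrite /B; case: (e i) => /=;
  rewrite ?mulN1r ?mul1r.
Qed.

Lemma iid_normal_second_moment_le (i : 'I_N) :
  (\int[P]_w (xi i w ^+ 2)%:E <= (8 * sigma ^+ 2)%:E)%E.
Proof.
case: hxi => _ law.
(* [normal_prob] lives on [measurableTypeR R], whose display differs from that
   of the canonical structure on [R] used by [distribution]. *)
have mxi : measurable_fun setT (xi i : T -> measurableTypeR R).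
  exact: (@measurable_funPT _ _ _ _ (xi i)).
have -> : (\int[P]_w (xi i w ^+ 2)%:E = \int[pushforward P
    (xi i : T -> measurableTypeR R)]_x (x ^+ 2)%:E)%E.
  rewrite ge0_integral_pushforward //.
  - by apply/measurable_EFinP; exact: exprn_measurable.
  - by move=> x _; rewrite lee_fin sqr_ge0.
apply: le_trans (normal_second_moment_le sigma_gt0).
rewrite le_eqVlt; apply/orP; left; apply/eqP.
by apply: (@eq_measure_integral _ _ _ _ (normal_prob 0 sigma)) => A mA _;
  exact: law.
Qed.

(** Symmetrization: every sign pattern [e] gives the same expectation, so [c] times the left side,
    with [c] the number of patterns, is the integral of a sum over [e]. The inequality for random
    signs bounds that sum at each sample point. *)
Lemma expected_maximal_ineq (d m : nat) (q : 'I_N -> 'I_d -> 'I_m)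
    (B : pred 'I_N) :
  (\int[P]_w ((\big[Num.max/0]_(j : {ffun 'I_d -> 'I_m})
     `|\sum_(i | B i && [forall s, (j s <= q i s)%N]) xi i w|) ^+ 2)%:E <=
   (4 ^+ d * (#|B|%:R * (8 * sigma ^+ 2)))%:E)%E.
Proof.
pose G (e : {ffun 'I_N -> bool}) w := (\big[Num.max/0]_(j : {ffun 'I_d -> 'I_m})
   `|signed_sum (fun i => B i && [forall s, (j s <= q i s)%N]) e
       (fun i => xi i w)|) ^+ 2.
pose F (t : N.-tuple R) := ((\big[Num.max/0]_(j : {ffun 'I_d -> 'I_m})
   `|\sum_(i | B i && [forall s, (j s <= q i s)%N]) tnth t i|) ^+ 2)%:E.
have mF : measurable_fun setT F.
  apply/measurable_EFinP; apply: measurable_funX; apply: measurable_bigmax => j.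
  apply: measurableT_comp => //.
  by apply: measurable_sum_cond => i; exact: measurable_tnth.
have F0 t : (0 <= F t)%E by rewrite lee_fin sqr_ge0.
have GF e : (\int[P]_w (G e w)%:E = \int[P]_w F [tuple xi i w | i < N])%E.
  rewrite -(@eq_joint_law_integral _ _ _ P _
    (fun i w => (-1) ^+ e i * xi i w) (fun i w => xi i w)) //.
  - apply: eq_integral => w _; congr ((_ ^+ 2)%:E); apply: eq_bigr => j _.
    by congr `|_|; apply: eq_bigr => i _; rewrite tnth_mktuple.
  - by move=> i; apply: measurable_funM.
  - exact: iid_normal_sign_symmetric.
pose c : R := #|{ffun 'I_N -> bool}|%:R.
have c0 : 0 < c by rewrite ltr0n card_ffun card_bool expn_gt0.
have G0 e w : 0 <= G e w by exact: sqr_ge0.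
rewrite [leLHS](_ : _ = \int[P]_w F [tuple xi i w | i < N])%E; last first.
  apply: eq_integral => w _; congr ((_ ^+ 2)%:E); apply: eq_bigr => j _.
  by congr `|_|; apply: eq_bigr => i _; rewrite tnth_mktuple.
rewrite -(@lee_pmul2l _ c%:E) ?lte_fin //.
have -> : (c%:E * \int[P]_w F [tuple xi i w | i < N] =
    \int[P]_w (\sum_e (G e w)%:E))%E.
  rewrite ge0_integral_sum //.
  - under eq_bigr do rewrite GF.
    by rewrite big_const iter_addr_0 mule_natl.
  - move=> e; apply/measurable_EFinP; apply: measurable_funX.
    apply: measurable_bigmax => j; apply: measurableT_comp => //.
    by apply: measurable_sum_cond => i; exact: measurable_funM.
  - by move=> e w _; rewrite lee_fin.
apply: (@le_trans _ _ (\int[P]_w (\sum_i ((4 ^+ d * c)%:E *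
    (if B i then (xi i w ^+ 2)%:E else 0))))%E).
  apply: ge0_le_integral_pointwise => w.
    by apply: sume_ge0 => e _; rewrite lee_fin.
  rewrite sumEFin -ge0_sume_distrr; last first.
    by move=> i _; case: ifP => // _; rewrite lee_fin sqr_ge0.
  rewrite -big_mkcond /= sumEFin -EFinM lee_fin -mulrA.
  exact: multiparameter_maximal_ineq.
rewrite ge0_integral_sum //; last 2 first.
- move=> i; case: (B i); last by rewrite mule0.
  by apply/measurable_EFinP; apply: measurable_funM => //; apply: measurable_funX.
- move=> i w _; rewrite mule_ge0 ?lee_fin ?mulr_ge0 ?exprn_ge0 ?(ltW c0) //.
  by case: ifP => // _; rewrite lee_fin sqr_ge0.
apply: (@le_trans _ _ (\sum_(i | B i) (4 ^+ d * c * (8 * sigma ^+ 2))%:E)%E).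
  rewrite [leRHS]big_mkcond /=; apply: lee_sum => i _.
  case: (B i); last first.
    by under eq_integral do rewrite mule0; rewrite integral0.
  rewrite ge0_integralZl //.
  - by rewrite [leRHS]EFinM lee_wpmul2l ?lee_fin ?iid_normal_second_moment_le //
       mulr_ge0 ?exprn_ge0 ?(ltW c0).
  - by apply/measurable_EFinP; apply: measurable_funX.
  - by move=> w _; rewrite lee_fin sqr_ge0.
  - by rewrite lee_fin mulr_ge0 ?exprn_ge0 ?(ltW c0).
rewrite sumEFin sumr_const -EFinM lee_fin -mulr_natl.
by rewrite le_eqVlt; apply/orP; left; apply/eqP; ring.
Qed.

End GaussianMaximal.

(** * Entirely monotone functions on a grid *)

(** Truncation at 0 does no harm below: a shift by 1 only occurs where [l < j]. *)
Definition ord_sub (m : nat) (j : 'I_m) (k : nat) : 'I_m :=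
  Ordinal (leq_ltn_trans (leq_subr k j) (ltn_ord j)).

(** Telescoping, written for the point mass at [k]. At [j = l] the difference has no lower term, so
    the initial value is kept. *)
Lemma sum_backward_diff (R : realType) (m : nat) (l i k : 'I_m) :
  (l <= i)%N ->
  \sum_(j : 'I_m | (l <= j <= i)%N) \sum_(e : bool | e ==> (l < j)%N)
    (-1) ^+ e * (k == ord_sub j e)%:R = (k == i)%:R :> R.
Proof.
move=> li.
have E (j : 'I_m) : (l <= j <= i)%N ->
    \sum_(e : bool | e ==> (l < j)%N) (-1) ^+ e * (k == ord_sub j e)%:R =
    (k == j)%:R - ((l < j)%N && (k.+1 == j))%:R :> R.
  move=> _; rewrite big_mkcond big_bool /= expr0 expr1 mul1r mulN1r addrC.
  rewrite -[in LHS](inj_eq val_inj) /= subn0 -[in RHS](inj_eq val_inj) /=.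
  congr (_ + _); case: ltnP => lj /=; last by rewrite oppr0.
  rewrite -(inj_eq val_inj) /=; congr (- _%:R); congr nat_of_bool.
  by apply/eqP/eqP; lia.
rewrite (eq_bigr _ E) sumrB.
have D (P : pred 'I_m) : \sum_(j | P j) (k == j)%:R = (P k)%:R :> R.
  rewrite big_mkcond (bigD1 k) //= eqxx big1 ?addr0; first by case: (P k).
  by move=> j /negbTE jk; rewrite eq_sym jk; case: ifP.
rewrite D.
have -> : \sum_(j : 'I_m | (l <= j <= i)%N) ((l < j)%N && (k.+1 == j))%:R =
    ((l <= k)%N && (k < i)%N)%:R :> R.
  have [/andP[lk ki]|h] := boolP ((l <= k)%N && (k < i)%N); last first.
    rewrite big1 // => j /andP[lj ji].
    case: andP => // -[lj' /eqP kj]; case/negP: h; apply/andP; lia.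
  have km : (k.+1 < m)%N by have := ltn_ord i; lia.
  rewrite (bigD1 (Ordinal km)) /=; last by lia.
  rewrite eqxx andbT ltnS lk big1 ?addr0 // => j /andP[_ jk].
  rewrite eq_sym; case: eqP => [kj|]; last by rewrite andbF.
  by case/eqP: jk; apply/val_inj.
rewrite -(inj_eq val_inj) /=.
have := ltnn i; case: (ltngtP k i) => ki; case: (leqP l k) => lk //=;
  rewrite ?subrr ?subr0 //; lia.
Qed.

(** The side condition on [e] freezes the coordinates with [j s = l s], exactly as [quasi_volume]
    freezes those in which its two corners agree. *)
Lemma mobius_inversion (R : realType) (d m : nat)
    (F : {ffun 'I_d -> 'I_m} -> R) (l i : {ffun 'I_d -> 'I_m}) :
  (forall s, (l s <= i s)%N) ->
  \sum_(j : {ffun 'I_d -> 'I_m} | [forall s, (l s <= j s <= i s)%N])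
    \sum_(e : {ffun 'I_d -> bool} | [forall s, e s ==> (l s < j s)%N])
      (-1) ^+ (\sum_s e s)%N * F [ffun s => ord_sub (j s) (e s)] = F i.
Proof.
move=> li.
(* The evaluation at [i] is a product over the coordinates of one-dimensional
   telescoping sums of backward differences. *)
transitivity (\sum_k F k * \prod_s
  (\sum_(j : 'I_m | (l s <= j <= i s)%N) \sum_(e : bool | e ==> (l s < j)%N)
    (-1) ^+ e * (k s == ord_sub j e)%:R : R)); last first.
  rewrite (bigD1 i) //= [X in _ + X]big1 ?addr0.
    rewrite big1 ?mulr1 // => s _.
    by rewrite sum_backward_diff // eqxx.
  move=> k /eqP ki.
  have [s ks] : exists s, k s != i s.
    apply/existsP; apply: contra_notT ki; rewrite negb_exists => /forallP h.
    by apply/ffunP => s; have := h s; rewrite negbK => /eqP.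
  by rewrite (bigD1 s) //= sum_backward_diff // (negbTE ks) mul0r mulr0.
have distr (k : {ffun 'I_d -> 'I_m}) : \prod_s
  (\sum_(j : 'I_m | (l s <= j <= i s)%N) \sum_(e : bool | e ==> (l s < j)%N)
    (-1) ^+ e * (k s == ord_sub j e)%:R : R) =
  \sum_(j : {ffun 'I_d -> 'I_m} | [forall s, (l s <= j s <= i s)%N])
    \sum_(e : {ffun 'I_d -> bool} | [forall s, e s ==> (l s < j s)%N])
      (-1) ^+ (\sum_s e s)%N * (k == [ffun s => ord_sub (j s) (e s)])%:R.
  rewrite (bigA_distr_big_dep (fun s (j : 'I_m) => (l s <= j <= i s)%N)
    (fun s j => \sum_(e : bool | e ==> (l s < j)%N)
      (-1) ^+ e * (k s == ord_sub j e)%:R)) /=.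
  apply: eq_big => [j|j _].
    by apply/familyP/forallP.
  rewrite (bigA_distr_big_dep (fun s (e : bool) => e ==> (l s < j s)%N)
    (fun s e => (-1) ^+ e * (k s == ord_sub (j s) e)%:R)) /=.
  apply: eq_big => [e|e _].
    by apply/familyP/forallP.
  rewrite big_split /= prodrXr; congr (_ * _).
  case: eqP => [kE|/eqP kj].
    by rewrite big1 // => s _; rewrite kE ffunE eqxx.
  have [s ks] : exists s, k s != ord_sub (j s) (e s).
    apply/existsP; apply: contraNT kj; rewrite negb_exists => /forallP h.
    by apply/eqP; apply/ffunP => s; have := h s; rewrite negbK ffunE => /eqP.
  by rewrite (bigD1 s) //= (negbTE ks) mul0r.
under [RHS]eq_bigr => k _.
  rewrite distr mulr_sumr; under eq_bigr do rewrite mulr_sumr.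
  over.
rewrite exchange_big; apply: eq_bigr => j _.
rewrite exchange_big; apply: eq_bigr => e _ /=.
rewrite (bigD1 [ffun s => ord_sub (j s) (e s)]) //= eqxx mulr1 mulrC.
by rewrite [X in _ + X]big1 ?addr0 // => k /negbTE ->; rewrite !mulr0.
Qed.

Definition grid_point (R : realType) (d : nat) (n : 'I_d -> nat)
    (j : 'I_d -> nat) : 'rV[R]_d := \row_s ((j s)%:R / (n s)%:R).

Section EntirelyMonotoneOnGrid.
Variables (R : realType) (d m : nat) (n : 'I_d -> nat).
Hypothesis n_gt0 : forall s, (0 < n s)%N.
Variable f : 'rV[R]_d -> R.
Hypothesis fEM : entirely_monotone f.

Let pt (j : {ffun 'I_d -> 'I_m}) : 'rV[R]_d := grid_point R n (fun s => j s).

Let in_grid (j : {ffun 'I_d -> 'I_m}) := forall s, (j s < n s)%N.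

(** The lower corner is one grid step below [pt j] in the coordinates where [j] exceeds [l] and
    agrees with it elsewhere. At [j = l] the corners coincide, and the increment is the value
    [f (pt l)], of arbitrary sign. *)
Definition grid_increment (l j : {ffun 'I_d -> 'I_m}) : R :=
  quasi_volume f (grid_point R n (fun s => j s - (l s < j s))%N) (pt j).

Lemma grid_increment_ge0 (l j : {ffun 'I_d -> 'I_m}) :
  in_grid j -> (forall s, (l s <= j s)%N) -> j != l ->
  0 <= grid_increment l j.
Proof.
move=> jn lj jl; apply: fEM.
- move=> s; rewrite mxE divr_ge0 //= ler_pdivrMr ?ltr0n // mul1r ler_nat.
  by have := jn s; lia.
- move=> s; rewrite mxE divr_ge0 //= ler_pdivrMr ?ltr0n // mul1r ler_nat.
  by have := jn s; lia.
- apply: contraNneq jl => /rowP E; apply/eqP; apply/ffunP => s; apply/val_inj.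
  have := E s; rewrite !mxE => /divIf; rewrite pnatr_eq0 -lt0n => /(_ (n_gt0 s)).
  by move=> /eqP; rewrite eqr_nat; have := lj s; case: ltngtP => // ?; lia.
- by move=> s; rewrite !mxE ler_wpM2r ?invr_ge0 // ler_nat leq_subr.
Qed.

Lemma grid_increment_sum (l i : {ffun 'I_d -> 'I_m}) :
  (forall s, (l s <= i s)%N) ->
  \sum_(j : {ffun 'I_d -> 'I_m} | [forall s, (l s <= j s <= i s)%N])
    grid_increment l j = f (pt i).
Proof.
move=> li; rewrite -(mobius_inversion (fun j => f (pt j)) li).
apply: eq_bigr => j /forallP lj; rewrite /grid_increment /quasi_volume.
have n0 s : (n s)%:R != 0 :> R by rewrite pnatr_eq0 -lt0n.
apply: eq_big => [e|e /forallP he].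
  apply: eq_forallb => s; congr (_ ==> _); rewrite !mxE.
  rewrite (inj_eq (divIf (n0 s))) eqr_nat.
  case: (ltnP (l s) (j s)) => h /=; last by rewrite subn0 eqxx.
  by rewrite ltn_eqF // ltn_subrL /= (leq_ltn_trans _ h).
congr (_ * f _); apply/rowP => s; rewrite !mxE ffunE /=.
have := he s; rewrite !mxE (inj_eq (divIf (n0 s))) eqr_nat.
case: (e s) => /=; last by rewrite mul0r addr0 subn0.
case: (ltnP (l s) (j s)) => h; last by rewrite subn0 eqxx.
by move=> _; rewrite mul1r addrC subrK.
Qed.

(** The analogue of a distribution function: apart from the value at [l], [f] accumulates the
    nonnegative masses of the points between [l] and [i]. *)
Lemma grid_increment_expansion (l i : {ffun 'I_d -> 'I_m}) :
  (forall s, (l s <= i s)%N) ->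
  f (pt i) = f (pt l) + \sum_(j : {ffun 'I_d -> 'I_m} |
    [forall s, (l s <= j s <= i s)%N] && (j != l)) grid_increment l j.
Proof.
move=> li; rewrite -(grid_increment_sum li) (bigD1 l) /=; last first.
  by apply/forallP => s; rewrite leqnn li.
congr (_ + _); rewrite -(@grid_increment_sum l l) // (big_pred1 l) // => j.
apply/forallP/eqP => [h|-> s]; last by rewrite leqnn.
by apply/ffunP => s; apply/val_inj; have := h s; rewrite -eqn_leq => /eqP.
Qed.

Lemma entirely_monotone_grid_le (l i : {ffun 'I_d -> 'I_m}) :
  in_grid i -> (forall s, (l s <= i s)%N) -> f (pt l) <= f (pt i).
Proof.
move=> ni li; rewrite (grid_increment_expansion li) lerDl sumr_ge0 //.
move=> j /andP[/forallP lj jl].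
apply: grid_increment_ge0 => // s; have /andP[h1 h2] := lj s => //.
exact: leq_ltn_trans h2 (ni s).
Qed.

End EntirelyMonotoneOnGrid.

(** * Dyadic blocks *)

(** An injection of [A] into two copies of [B]. The bit records the parity lost when a distance is
    halved. *)
Lemma leq_card_double (N : nat) (A B : pred nat) (g : nat -> nat * bool) :
  (forall i, (i < N)%N -> A i -> ((g i).1 < N)%N && B (g i).1) ->
  (forall i j, (i < N)%N -> (j < N)%N -> A i -> A j -> g i = g j -> i = j) ->
  (#|[pred i : 'I_N | A i]| <= 2 * #|[pred i : 'I_N | B i]|)%N.
Proof.
move=> gAB ginj.
pose h (i : 'I_N) : 'I_N * bool := (insubd i (g i).1, (g i).2).
have hv (i : 'I_N) : A i -> (h i).1 = (g i).1 :> nat.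
  by move=> Ai; rewrite /h /= val_insubd; case/andP: (gAB i (ltn_ord i) Ai) => ->.
have -> : (2 * #|[pred i : 'I_N | B i]| =
    #|[predX [pred i : 'I_N | B i] & predT : pred bool]|)%N.
  by rewrite cardX card_bool mulnC.
rewrite -(@card_in_imset _ _ h); last first.
  move=> i j; rewrite !inE => Ai Aj hij; apply/val_inj.
  apply: (ginj _ _ (ltn_ord i) (ltn_ord j) Ai Aj).
  have g1 : (g i).1 = (g j).1 by rewrite -!hv // hij.
  have g2 : (g i).2 = (g j).2 by case: hij.
  by move: g1 g2; case: (g i) => ? ?; case: (g j) => ? ? /= -> ->.
apply/subset_leq_card/fintype.subsetP => _ /imsetP[i + ->].
rewrite !inE /= => Ai; rewrite hv //.
by case/andP: (gAB i (ltn_ord i) Ai) => _ ->.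
Qed.

Lemma down_closed_threshold (p : pred nat) (n : nat) :
  (forall i j, (i <= j < n)%N -> p j -> p i) ->
  exists2 t, (t <= n)%N & forall i, (i < n)%N -> p i = (i < t)%N.
Proof.
elim: n => [|n IH] hp; first by exists 0%N.
have [pn|pn] := boolP (p n).
  exists n.+1 => // i; rewrite ltnS => ilen.
  by rewrite ilen; apply: (hp i n) => //; rewrite ilen ltnS leqnn.
have [|t tn ht] := IH.
  by move=> i j /andP[ij jn]; apply: hp; rewrite ij ltnS ltnW.
exists t => [|i]; first exact: leqW.
rewrite ltnS leq_eqVlt => /orP[/eqP ->|]; last exact: ht.
by rewrite (negbTE pn); apply/esym/negbTE; rewrite -leqNgt.
Qed.

Lemma monotone_fiber_interval (c : nat -> nat) (n k : nat) :
  (forall i j, (i <= j < n)%N -> (c i <= c j)%N) ->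
  exists lh : nat * nat, (lh.2 <= n)%N /\
    forall i, (i < n)%N -> (c i == k) = (lh.1 <= i < lh.2)%N.
Proof.
move=> hc.
have [|lo lon hlo] := @down_closed_threshold (fun i => c i < k)%N n.
  by move=> i j /hc; exact: leq_ltn_trans.
have [|hi hin hhi] := @down_closed_threshold (fun i => c i <= k)%N n.
  by move=> i j /hc; exact: leq_trans.
exists (lo, hi); split=> // i ilt /=.
by rewrite leqNgt -hlo // -hhi // -leqNgt eqn_leq andbC.
Qed.

Section DyadicBlocks.
Variables (N M K n : nat) (c : nat -> 'I_M).
Hypotheses (nN : (n <= N)%N) (nK : (trunc_log 2 n < K)%N).
Hypothesis c_mono : forall i j, (i <= j < n)%N -> (c i <= c j)%N.

(* A label consists of the cell, the half of the cell and the dyadic scale of the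
   distance to the nearer end. For a block in the left half, [up] is its mirror
   image in the right half; for one in the right half, it is a set of
   comparable size closer to the right end. [down] is symmetric. *)
Lemma dyadic_blocks :
  exists (lab : nat -> 'I_M * (bool * 'I_K))
    (up down : 'I_M * (bool * 'I_K) -> nat -> bool),
  [/\ forall i, (i < n)%N -> (lab i).1 = c i,
      forall i j, (i < n)%N -> (j < n)%N -> up (lab i) j ->
        (i <= j)%N /\ c j = c i,
      forall i j, (i < n)%N -> (j < n)%N -> down (lab i) j ->
        (j <= i)%N /\ c j = c i,
      forall b, (#|[pred i : 'I_N | (i < n)%N && (lab i == b)]| <=
         2 * #|[pred i : 'I_N | (i < n)%N && up b i]|)%N /\
        (#|[pred i : 'I_N | (i < n)%N && (lab i == b)]| <=
         2 * #|[pred i : 'I_N | (i < n)%N && down b i]|)%N &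
      forall i b b', (i < n)%N -> b.2.1 = b'.2.1 ->
        (up b i -> up b' i -> b = b') /\ (down b i -> down b' i -> b = b')].
Proof.
have [lh hlh] := boolp.choice (fun k : 'I_M =>
  monotone_fiber_interval k c_mono).
pose lo k := (lh k).1; pose hi k := (lh k).2.
have hin k : (hi k <= n)%N by have [] := hlh k.
have cE k i : (i < n)%N -> (c i == k) = (lo k <= i < hi k)%N.
  by move=> ilt; have [_ <-] := hlh k.
have cell i : (i < n)%N -> (lo (c i) <= i < hi (c i))%N.
  by move=> ilt; rewrite -cE.
case: K nK => [|K'] nK'; first by [].
(* Both distances count [i] itself, so they are at least 1 inside the cell and have a dyadic
   scale. *)
pose left k i := (i - lo k).+1; pose right k i := (hi k - i)%N.
pose side i := (left (c i) i <= right (c i) i)%N.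
pose w i := if side i then left (c i) i else right (c i) i.
pose lab i : 'I_M * (bool * 'I_K'.+1) :=
  (c i, (side i, inord (trunc_log 2 (w i)))).
have w_n i : (i < n)%N -> (0 < w i <= n)%N.
  move=> ilt; have := cell i ilt; have := hin (c i).
  by rewrite /w /left /right; case: (side i); lia.
have labE i : (i < n)%N -> (2 ^ (lab i).2.2 <= w i < 2 * 2 ^ (lab i).2.2)%N.
  move=> ilt; have /andP[w0 wn] := w_n i ilt; rewrite /lab /= inordK.
    by rewrite -expnS; exact: trunc_log_bounds.
  by apply: leq_ltn_trans nK'; exact: leq_trunc_log.
(* [exact] is the dyadic range of a block. [near] is its image under [x |-> x./2 + 1], hence at most
   [2 ^ a] and no farther from the end than the block; the doubled inequality also covers
   [a = 0]. *)
pose near (x : nat -> nat) (a : nat) i := (2 ^ a < 2 * x i <= 2 * 2 ^ a)%N.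
pose exact (x : nat -> nat) (a : nat) i := (2 ^ a <= x i < 2 * 2 ^ a)%N.
pose up (b : 'I_M * (bool * 'I_K'.+1)) i := let: (k, (sd, a)) := b in
  (lo k <= i < hi k)%N && if sd then (right k i <= left k i)%N &&
    exact (right k) a i else near (right k) a i.
pose down (b : 'I_M * (bool * 'I_K'.+1)) i := let: (k, (sd, a)) := b in
  (lo k <= i < hi k)%N && if sd then near (left k) a i else
    (left k i <= right k i)%N && exact (left k) a i.
exists lab, up, down; split.
- by [].
- move=> i j ilt jlt.
  have := labE i ilt; have := cell i ilt.
  rewrite /up /lab /=; set a := (inord _ : 'I_ _).
  rewrite /w /side /exact /near /left /right -(cE (c i) j) //.
  move: (2 ^ a)%N => p.
  by case: ifP => hs hc hp /andP[/eqP cji hj]; split=> //;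
    have := cell j jlt; rewrite cji; lia.
- move=> i j ilt jlt.
  have := labE i ilt; have := cell i ilt.
  rewrite /down /lab /=; set a := (inord _ : 'I_ _).
  rewrite /w /side /exact /near /left /right -(cE (c i) j) //.
  move: (2 ^ a)%N => p.
  by case: ifP => hs hc hp /andP[/eqP cji hj]; split=> //;
    have := cell j jlt; rewrite cji; lia.
- move=> [k [sd a]].
  have labP i : (i < n)%N -> lab i == (k, (sd, a)) ->
     [/\ (lo k <= i < hi k)%N, sd = (left k i <= right k i)%N &
       (2 ^ a <= (if sd then left k i else right k i) < 2 * 2 ^ a)%N].
    move=> ilt /eqP E; have := labE i ilt; have := cell i ilt.
    have cik : c i = k by case: E.
    have sdE : side i = sd by case: E.
    rewrite E /= /w sdE cik => h1 h2; split=> //.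
    by move: sdE; rewrite /side cik => ->.
  (* [mirror] exchanges [left] and [right] and is injective by itself. The halving maps send a
     distance [x] to [x./2 + 1] and keep its parity. *)
  pose mirror i := ((lo k + hi k).-1 - i, false)%N.
  pose halve_r i := ((hi k - ((hi k - i)./2).+1)%N, odd (hi k - i)).
  pose halve_l i := ((lo k + ((i - lo k).+1)./2)%N, odd (i - lo k).+1).
  have hk := hin k.
  split.
  + apply: (@leq_card_double N
      (fun i => (i < n)%N && (lab i == (k, (sd, a))))
      (fun i => (i < n)%N && up (k, (sd, a)) i)
      (fun i => if sd then mirror i else halve_r i)).
      move=> i iN /andP[ilt /(labP _ ilt)[ik sdE]].
      rewrite /up; move: sdE; rewrite /exact /near /left /right.
      case: sd {labP} => [/esym h|/esym h] hp /=; first by move: (2 ^ a)%N hp => p; lia.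
      move: (2 ^ a)%N hp => p; have := odd_double_half (hi k - i).
      by rewrite -addnn; case: (odd _) => /=; lia.
    move=> i j iN jN /andP[ilt /(labP _ ilt)[ik sdE _]]
      /andP[jlt /(labP _ jlt)[jk sdE' _]].
    case: sd sdE sdE' {labP} => _ _ [e1]; first lia.
    have := odd_double_half (hi k - i); have := odd_double_half (hi k - j).
    by rewrite -!addnn => o1 o2 e2; move: o1 o2; rewrite e2; lia.
  + apply: (@leq_card_double N
      (fun i => (i < n)%N && (lab i == (k, (sd, a))))
      (fun i => (i < n)%N && down (k, (sd, a)) i)
      (fun i => if sd then halve_l i else mirror i)).
      move=> i iN /andP[ilt /(labP _ ilt)[ik sdE]].
      rewrite /down; move: sdE; rewrite /exact /near /left /right.
      case: sd {labP} => [/esym h|/esym h] hp /=; last by move: (2 ^ a)%N hp => p; lia.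
      move: (2 ^ a)%N hp => p; have := odd_double_half (i - lo k).+1.
      by rewrite -addnn; case: (odd _) => /=; lia.
    move=> i j iN jN /andP[ilt /(labP _ ilt)[ik sdE _]]
      /andP[jlt /(labP _ jlt)[jk sdE' _]].
    case: sd sdE sdE' {labP} => _ _ E; last by case: E; lia.
    have e2 : odd (i - lo k).+1 = odd (j - lo k).+1 := congr1 snd E.
    have := odd_double_half (i - lo k).+1; have := odd_double_half (j - lo k).+1.
    have e1 : (lo k + ((i - lo k).+1)./2 = lo k + ((j - lo k).+1)./2)%N :=
      congr1 fst E.
    by rewrite -!addnn e2; lia.
- move=> i [k [sd a]] [k' [sd' a']] ilt /= <-.
  (* Different scales have disjoint ranges, so a point and a side leave only one cell and one
     scale. *)
  have exactI (x : nat -> nat) (b b' : 'I_K'.+1) :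
      exact x b i -> exact x b' i -> b = b'.
    rewrite /exact => /andP[h1 h2] /andP[h1' h2']; apply/val_inj.
    have := leq_ltn_trans h1 h2'; have := leq_ltn_trans h1' h2.
    rewrite -!expnS !ltn_exp2l // /=; lia.
  have nearI (x : nat -> nat) (b b' : 'I_K'.+1) :
      near x b i -> near x b' i -> b = b'.
    rewrite /near => /andP[h1 h2] /andP[h1' h2']; apply/val_inj.
    have := leq_trans h1 h2'; have := leq_trans h1' h2.
    rewrite -!expnS !ltn_exp2l // /=; lia.
  rewrite /up /down -!cE //; split.
  + case/andP => /eqP <- h1 /andP[/eqP <- h2]; congr (_, (_, _)).
    case: sd h1 h2 => [/andP[_ h1] /andP[_ h2]|h1 h2].
      exact: exactI h1 h2.
    exact: nearI h1 h2.
  + case/andP => /eqP <- h1 /andP[/eqP <- h2]; congr (_, (_, _)).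
    case: sd h1 h2 => [h1 h2|/andP[_ h1] /andP[_ h2]].
      exact: nearI h1 h2.
    exact: exactI h1 h2.
Qed.

End DyadicBlocks.

(** * Blockwise control of the noise *)

(** The value [p b ^+ 2] is charged to the points of [up b], which number at least [#|A b| / k];
    each point is charged at most [m] times. *)
Lemma sum_card_sqr_le (R : realType) (I B : finType) (A up : B -> pred I)
    (k m : nat) (v : I -> R) (p : B -> R) :
  (forall b, (#|A b| <= k * #|up b|)%N) ->
  (forall i, (#|[pred b | up b i]| <= m)%N) ->
  (forall b, 0 <= p b) -> (forall b i, up b i -> p b <= `|v i|) ->
  \sum_b #|A b|%:R * p b ^+ 2 <= (k * m)%:R * \sum_i v i ^+ 2.
Proof.
move=> hA hm p0 hp.
apply: (@le_trans _ _ (\sum_b k%:R * \sum_(i | up b i) v i ^+ 2)).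
  apply: ler_sum => b _.
  apply: (@le_trans _ _ ((k * #|up b|)%:R * p b ^+ 2)).
    by rewrite ler_wpM2r ?sqr_ge0 // ler_nat.
  rewrite natrM -mulrA ler_wpM2l // mulr_natl -sumr_const.
  apply: ler_sum => i hi; rewrite -[leRHS]real_normK ?num_real //.
  by rewrite lerXn2r ?nnegrE //; exact: hp.
rewrite -mulr_sumr natrM -mulrA ler_wpM2l //.
under eq_bigr do rewrite big_mkcond.
rewrite exchange_big mulr_sumr /=; apply: ler_sum => i _.
rewrite -big_mkcond sumr_const -[leLHS]mulr_natl ler_wpM2r ?sqr_ge0 // ler_nat.
exact: hm.
Qed.

Lemma blockwise_quadratic_bound (R : realType) (I B : finType)
    (lab : I -> B) (up down : B -> pred I) (k m : nat)
    (v xi : I -> R) (p q S : B -> R) :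
  (0 < k * m)%N ->
  (forall b, (#|[pred i | lab i == b]| <= k * #|up b|)%N) ->
  (forall b, (#|[pred i | lab i == b]| <= k * #|down b|)%N) ->
  (forall i, (#|[pred b | up b i]| <= m)%N) ->
  (forall i, (#|[pred b | down b i]| <= m)%N) ->
  (forall b, 0 <= p b) -> (forall b i, up b i -> p b <= `|v i|) ->
  (forall b, 0 <= q b) -> (forall b i, down b i -> q b <= `|v i|) ->
  (forall b, `|\sum_(i | lab i == b) xi i * v i| <= (p b + 2 * q b) * S b) ->
  2 * \sum_i xi i * v i - \sum_i v i ^+ 2 <=
  16 * (k * m)%:R * \sum_b S b ^+ 2 / #|[pred i | lab i == b]|%:R.
Proof.
move=> km0 hup hdown mup mdown p0 pv q0 qv hS.
have c0 : 0 < 16 * (k * m)%:R :> R by rewrite mulr_gt0 // ltr0n.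
(* The terms in [p] and [q] will each cost at most [8 / c * (k * m)] times the sum of squares of
   [v]; this [c] makes their total exactly that sum. *)
set c := 16 * (k * m)%:R in c0 *.
have blocks : 2 * \sum_i xi i * v i <= \sum_b
    (8 / c * (#|[pred i | lab i == b]|%:R * p b ^+ 2 +
              #|[pred i | lab i == b]|%:R * q b ^+ 2) +
     c * (S b ^+ 2 / #|[pred i | lab i == b]|%:R)).
  rewrite (partition_big lab xpredT) //= mulr_sumr; apply: ler_sum => b _.
  have := hS b; set T := \sum_(i | _) _ => hT.
  (* For an empty block the inverse of 0 is 0, and both sides vanish. *)
  have [b0|b1] := posnP #|[pred i | lab i == b]|.
    rewrite /T big_pred0; last by move=> i; have := card0_eq b0 i.
    by rewrite b0 !mul0r invr0 !mulr0 !addr0 mulr0.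
  set n := #|_|%:R; have n0 : 0 < n by rewrite ltr0n.
  have Tle : T <= (p b + 2 * q b) * S b by apply: le_trans hT; exact: ler_norm.
  (* AM-GM with weight [n / c], then (p + 2 q)^2 <= 8 (p^2 + q^2) *)
  move: (p b) (q b) (S b) Tle => x y z Tle.
  have amgm : 2 * ((x + 2 * y) * z) <=
      n / c * (x + 2 * y) ^+ 2 + c * (z ^+ 2 / n).
    rewrite -subr_ge0 (_ : _ - _ =
      (n * c)^-1 * (n * (x + 2 * y) - c * z) ^+ 2); last first.
      by field; rewrite !gt_eqF.
    by rewrite mulr_ge0 ?sqr_ge0 // invr_ge0 mulr_ge0 ?(ltW n0) ?(ltW c0).
  have sq : n / c * (x + 2 * y) ^+ 2 <= 8 / c * (n * x ^+ 2 + n * y ^+ 2).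
    rewrite [leRHS](_ : _ = n / c * (8 * (x ^+ 2 + y ^+ 2))); last first.
      by field; rewrite gt_eqF.
    rewrite ler_wpM2l ?divr_ge0 ?(ltW n0) ?(ltW c0) //.
    by have := sqr_ge0 (2 * x - y); have := sqr_ge0 y; have := sqr_ge0 x; nra.
  lra.
have up_le := sum_card_sqr_le hup mup p0 pv.
have down_le := sum_card_sqr_le hdown mdown q0 qv.
rewrite lerBlDr; apply: le_trans blocks _.
rewrite big_split /= -mulr_sumr addrC lerD // -?mulr_sumr //.
rewrite big_split /= mulrAC ler_pdivrMr //.
rewrite [in leRHS]/c.
move: up_le down_le; set V := \sum_i v i ^+ 2.
set U := \sum_b _; set D := \sum_b _; lra.
Qed.

(** Exchanging the sums turns the left side into [v0 * S l] plus a combination of the orthant sums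
    [S j] with weights [w j]. The orthant at [l] contains the whole block. *)
Lemma block_sum_bound (R : realType) (I : finType) (d N : nat)
    (b : pred I) (q : I -> {ffun 'I_d -> 'I_N}) (l r : {ffun 'I_d -> 'I_N})
    (w : {ffun 'I_d -> 'I_N} -> R) (v0 : R) (v xi : I -> R) :
  (forall i, b i -> forall s, (l s <= q i s <= r s)%N) ->
  (forall j : {ffun 'I_d -> 'I_N},
    (forall s, (l s <= j s <= r s)%N) -> j != l -> 0 <= w j) ->
  (forall i, b i -> v i = v0 +
    \sum_(j : {ffun 'I_d -> 'I_N} |
        [forall s, (l s <= j s <= q i s)%N] && (j != l)) w j) ->
  `|\sum_(i | b i) xi i * v i| <=
  (`|v0| + \sum_(j : {ffun 'I_d -> 'I_N} |
        [forall s, (l s <= j s <= r s)%N] && (j != l)) w j) *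
  \big[Num.max/0]_(j : {ffun 'I_d -> 'I_N})
     `|\sum_(i | b i && [forall s, (j s <= q i s)%N]) xi i|.
Proof.
move=> hb w0 hv.
pose S (j : {ffun 'I_d -> 'I_N}) :=
  \sum_(i | b i && [forall s, (j s <= q i s)%N]) xi i.
have SM j : `|S j| <= \big[Num.max/0]_j `|S j| by exact: le_bigmax.
have -> : \sum_(i | b i) xi i * v i = v0 * S l +
    \sum_(j : {ffun 'I_d -> 'I_N} |
        [forall s, (l s <= j s <= r s)%N] && (j != l)) w j * S j.
  under eq_bigr => i bi do rewrite hv // mulrDr.
  rewrite big_split /=; congr (_ + _).
    rewrite -mulr_suml mulrC; congr (_ * _); apply: eq_bigl => i.
    case bi: (b i) => //=; apply/esym/forallP => s.
    by have /andP[] := hb i bi s.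
  under eq_bigr => i bi do rewrite mulr_sumr.
  rewrite (exchange_big_dep (fun j : {ffun 'I_d -> 'I_N} =>
     [forall s, (l s <= j s <= r s)%N] && (j != l))) /=.
    apply: eq_bigr => j /andP[/forallP hj jl]; rewrite mulr_sumr.
    apply: eq_big => [i|i _]; last by rewrite mulrC.
    case: (b i) => //=; rewrite jl andbT; apply: eq_forallb => s.
    by have /andP[-> _] := hj s.
  move=> i j bi /andP[/forallP hj ->]; rewrite andbT; apply/forallP => s.
  have /andP[-> h] := hj s; have /andP[_ h'] := hb i bi s.
  exact: leq_trans h h'.
apply: le_trans (ler_normD _ _) _.
rewrite mulrDl normrM; apply: lerD; first by rewrite ler_wpM2l.
apply: le_trans (ler_norm_sum _ _ _) _; rewrite mulr_suml.
apply: ler_sum => j /andP[/forallP hj jl].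
by rewrite normrM ger0_norm ?w0 // ler_wpM2l // w0.
Qed.

(** * The lattice design as an integer grid *)

Section LatticeGrid.
Variables (R : realType) (d : nat) (n : 'I_d -> nat).
Hypothesis n_gt0 : forall s, (1 <= n s)%N.
Variable N : nat.
Hypothesis NE : N = (\prod_s n s)%N.

(** Lets the indices of all coordinates live in the single type ['I_N]. *)
Lemma lattice_side_le (s : 'I_d) : (n s <= N)%N.
Proof.
rewrite NE (bigD1 s) //= leq_pmulr // prodn_cond_gt0 // => j _; exact: n_gt0.
Qed.

Lemma grid_point_inj (j k : {ffun 'I_d -> 'I_N}) :
  grid_point R n (fun s => j s) = grid_point R n (fun s => k s) -> j = k.
Proof.
move=> /rowP E; apply/ffunP => s; apply/val_inj.
have := E s; rewrite !mxE => /divIf.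
rewrite pnatr_eq0 -lt0n => /(_ (n_gt0 s)) /eqP.
by rewrite eqr_nat => /eqP.
Qed.

Lemma lattice_enumeration (x : 'I_N -> 'rV[R]_d) :
  set_bij [set: 'I_N] (lattice n) x ->
  exists q : 'I_N -> {ffun 'I_d -> 'I_N},
  [/\ injective q, forall i s, (q i s < n s)%N,
    forall j : {ffun 'I_d -> 'I_N}, (forall s, (j s < n s)%N) ->
      exists i, q i = j &
    forall i, x i = grid_point R n (fun s => q i s)].
Proof.
case=> fun_x inj_x surj_x.
have /boolp.choice[q hq] : forall i, exists q : {ffun 'I_d -> 'I_N},
    (forall s, (q s < n s)%N) /\ x i = grid_point R n (fun s => q s).
  move=> i; have [k kn ->] := fun_x i I.
  exists [ffun s => Ordinal (leq_trans (kn s) (lattice_side_le s))].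
  split => [s|]; first by rewrite ffunE /=; exact: kn.
  by apply/rowP => s; rewrite !mxE ffunE.
exists q; split.
- move=> i j qij; apply: inj_x; rewrite ?inE //.
  by have [_ ->] := hq i; have [_ ->] := hq j; rewrite qij.
- by move=> i; case: (hq i).
- move=> j jn; have [|i _ xi] := surj_x (grid_point R n (fun s => j s)).
    by exists (fun s => j s).
  by exists i; apply: grid_point_inj; rewrite -xi; case: (hq i).
- by move=> i; case: (hq i).
Qed.

Variable q : 'I_N -> {ffun 'I_d -> 'I_N}.
Hypotheses (q_inj : injective q) (q_lt : forall i s, (q i s < n s)%N).
Hypothesis q_surj : forall j : {ffun 'I_d -> 'I_N},
  (forall s, (j s < n s)%N) -> exists i, q i = j.

(** Reduces size comparisons of blocks to one coordinate at a time. *)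
Lemma card_lattice_box (A : 'I_d -> nat -> bool) :
  #|[pred i | [forall s, A s (q i s)]]| =
  (\prod_s #|[pred k : 'I_N | (k < n s)%N && A s k]|)%N.
Proof.
transitivity #|family (fun s => [pred k : 'I_N | (k < n s)%N && A s k])|;
  last by rewrite card_family foldrE big_map big_enum.
rewrite -(@card_imset _ _ q) //; apply: eq_card => j.
apply/imsetP/familyP => [[i hi ->] s|h].
  by rewrite inE q_lt /=; move: hi; rewrite inE => /forallP; apply.
have [|i qi] := q_surj (j := j).
  by move=> s; have := h s; rewrite inE => /andP[].
exists i => //; rewrite inE; apply/forallP => s.
by have := h s; rewrite inE qi => /andP[].
Qed.

End LatticeGrid.

(** * Cells of the competitor along the lattice *)

Section PartitionCells.
Variables (R : realType) (d : nat) (n : 'I_d -> nat).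
Hypothesis n_gt0 : forall s, (1 <= n s)%N.
Variables (p : 'I_d -> seq R) (f : 'rV[R]_d -> R).
Hypothesis fp : constant_on_cells p f.

(** Since [p s] omits the break point 0, the position of the first break point beyond [k / n s] is
    the index [l] of the half-open cell in [is_univ_cell]. The cell [[set 1]] is never met, as
    lattice coordinates are below 1. *)
Definition cell_index (s : 'I_d) (k : nat) : nat :=
  find (fun z => k%:R / (n s)%:R < z) (p s).

Lemma cell_index_lt (s : 'I_d) (k : nat) :
  (k < n s)%N -> (cell_index s k < size (p s))%N.
Proof.
move=> kn; have [/(_ s)[_ last1] _] := fp.
have k1 : k%:R / (n s)%:R < 1 :> R by rewrite ltr_pdivrMr ?ltr0n // mul1r ltr_nat.
rewrite -has_find; apply/hasP; exists 1 => //.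
have := mem_last 0 (p s); rewrite (eqP last1) inE => /orP[/eqP|//].
by move=> /eqP; rewrite oner_eq0.
Qed.

Lemma cell_index_mono (s : 'I_d) (i j : nat) :
  (i <= j)%N -> (cell_index s i <= cell_index s j)%N.
Proof.
move=> ij; apply: sub_find => z; apply: le_lt_trans.
by rewrite ler_wpM2r ?invr_ge0 // ler_nat.
Qed.

Lemma cell_index_const (j k : 'I_d -> nat) :
  (forall s, (j s < n s)%N) ->
  (forall s, cell_index s (k s) = cell_index s (j s)) ->
  f (grid_point R n k) = f (grid_point R n j).
Proof.
move=> jn jk; have [_ fc] := fp.
pose A s := `[(0 :: p s)`_(cell_index s (j s)),
              (0 :: p s)`_(cell_index s (j s)).+1[%classic.
have inA s (i : nat) : cell_index s i = cell_index s (j s) ->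
    A s (i%:R / (n s)%:R).
  move=> E; rewrite /A -E /= in_itv /=; apply/andP; split; last first.
    by apply: (@nth_find _ 0 (fun z => i%:R / (n s)%:R < z));
      rewrite has_find -/(cell_index s i) E cell_index_lt.
  case Ei: (cell_index s i) => [|m]; first by rewrite /= divr_ge0.
  by rewrite /= leNgt (@before_find _ 0 (fun z => i%:R / (n s)%:R < z)) //
     -/(cell_index s i) Ei.
apply: (fc [set x | forall s, A s (x 0 s)]).
- exists A => // s; left; exists (cell_index s (j s)) => //.
  exact: cell_index_lt.
- by move=> s; rewrite mxE; apply: inA.
- by move=> s; rewrite mxE; apply: inA.
Qed.

End PartitionCells.

(** * Dyadic blocks in dimension [d] and the noise bound *)

(** Applied with [h] the side bit: a point lies in at most one set [up b] for each choice of sides,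
    whence the overlap [2 ^ d]. *)
Lemma card_pred_family_le (I T : finType) (U : finType) (A : pred {ffun I -> T})
    (h : T -> U) :
  (forall b b' : {ffun I -> T}, A b -> A b' ->
    (forall s, h (b s) = h (b' s)) -> b = b') ->
  (#|A| <= #|U| ^ #|I|)%N.
Proof.
move=> hA; rewrite -card_ffun.
rewrite -(@card_in_imset _ _ (fun b : {ffun I -> T} => [ffun s => h (b s)])).
  exact: max_card.
move=> b b' bA b'A /ffunP E; apply: hA => // s.
by have := E s; rewrite !ffunE.
Qed.

(** Products of the one-dimensional blocks. Each coordinate contributes a factor 2 to the size
    comparison, a factor 2 to the overlap, and [size (p s)] cells times 2 sides times the number of
    scales to the count. *)
Lemma dyadic_partition (R : realType) (d : nat) (n : 'I_d -> nat) (N : nat)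
    (q : 'I_N -> {ffun 'I_d -> 'I_N}) (p : 'I_d -> seq R) (f : 'rV[R]_d -> R) :
  (forall s, (1 <= n s)%N) -> N = (\prod_s n s)%N ->
  injective q -> (forall i s, (q i s < n s)%N) ->
  (forall j : {ffun 'I_d -> 'I_N}, (forall s, (j s < n s)%N) ->
    exists i, q i = j) ->
  constant_on_cells p f ->
  exists (B : finType) (lab : 'I_N -> B) (up down : B -> pred 'I_N),
  [/\ (#|[pred b | [exists i, lab i == b]]| <=
        (\prod_s size (p s)) * (2 * (trunc_log 2 N).+1) ^ d)%N,
    forall b, (#|[pred i | lab i == b]| <= 2 ^ d * #|up b|)%N /\
              (#|[pred i | lab i == b]| <= 2 ^ d * #|down b|)%N,
    forall i, (#|[pred b | up b i]| <= 2 ^ d)%N /\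
              (#|[pred b | down b i]| <= 2 ^ d)%N &
    [/\ forall i j s, up (lab i) j -> (q i s <= q j s)%N,
        forall i j s, down (lab i) j -> (q j s <= q i s)%N &
        forall i j s, up (lab i) j || down (lab i) j || (lab i == lab j) ->
          cell_index n p s (q i s) = cell_index n p s (q j s)]].
Proof.
move=> n_gt0 NE q_inj q_lt q_surj fp.
(* A common bound on the cell indices gives all coordinates the same label type; the count is
   restricted to labels that occur, so [M] does not enter it. *)
pose M := (\max_s size (p s)).+1.
have cM s k : (cell_index n p s k < M)%N.
  rewrite ltnS (leq_trans (find_size _ _)) //.
  exact: (leq_bigmax_cond (F := fun s => size (p s))).
pose c s k : 'I_M := Ordinal (cM s k).
pose K := (trunc_log 2 N).+1.
have /boolp.choice[D hD] s := @dyadic_blocks N M K (n s) (c s)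
  (lattice_side_le n_gt0 NE s) (leq_trunc_log 2 (lattice_side_le n_gt0 NE s))
  (fun i j ij => cell_index_mono n p s (proj1 (andP ij))).
have /boolp.choice[U hU] := hD.
have /boolp.choice[W hW] := hU.
pose lab i : {ffun 'I_d -> 'I_M * (bool * 'I_K)} := [ffun s => D s (q i s)].
pose up (b : {ffun 'I_d -> 'I_M * (bool * 'I_K)}) : pred 'I_N :=
  fun i => [forall s, U s (b s) (q i s)].
pose down (b : {ffun 'I_d -> 'I_M * (bool * 'I_K)}) : pred 'I_N :=
  fun i => [forall s, W s (b s) (q i s)].
exists {ffun 'I_d -> 'I_M * (bool * 'I_K)}, lab, up, down.
have labE b : #|[pred i | lab i == b]| =
    (\prod_s #|[pred k : 'I_N | (k < n s)%N && (D s k == b s)]|)%N.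
  rewrite -(card_lattice_box q_inj q_lt q_surj (fun s k => D s k == b s)).
  apply: eq_card => i; rewrite !inE; apply/eqP/forallP => [<- s|h].
    by rewrite ffunE.
  by apply/ffunP => s; rewrite ffunE; apply/eqP.
have pow2 (F G : 'I_d -> nat) : (forall s, (F s <= 2 * G s)%N) ->
    (\prod_s F s <= 2 ^ d * \prod_s G s)%N.
  move=> FG; apply: (@leq_trans (\prod_s (2 * G s))%N).
    by apply: leq_prod => s _; exact: FG.
  by rewrite big_split /= prod_nat_const card_ord.
split.
- apply: (@leq_trans #|family (fun s =>
    [pred b : 'I_M * (bool * 'I_K) | (b.1 < size (p s))%N])|).
    apply/subset_leq_card/fintype.subsetP => b; rewrite inE => /existsP[i /eqP <-].
    apply/familyP => s; rewrite ffunE inE.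
    by have [-> //] := hW s; rewrite /c /= (cell_index_lt n_gt0 fp).
  rewrite card_family foldrE big_map big_enum /=.
  rewrite -[X in (_ ^ X)%N]card_ord -prod_nat_const -big_split /=.
  apply: leq_prod => s _.
  have -> : #|[pred b : 'I_M * (bool * 'I_K) | (b.1 < size (p s))%N]| =
      #|[predX [pred a : 'I_M | (a < size (p s))%N] & predT : pred (bool * 'I_K)]|.
    by apply: eq_card => b; rewrite !inE andbT.
  rewrite cardX card_prod card_bool card_ord leq_mul2r; apply/orP; right.
  apply: leq_trans (_ : #|[seq (inord k : 'I_M) | k : 'I_(size (p s))]| <= _)%N.
    apply/subset_leq_card/fintype.subsetP => a; rewrite inE => am.
    by apply/fintype.imageP; exists (Ordinal am) => //; rewrite /= inord_val.
  by rewrite -[leqRHS]card_ord leq_image_card.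
- move=> b; rewrite labE.
  rewrite (card_lattice_box q_inj q_lt q_surj (fun s => U s (b s))).
  rewrite (card_lattice_box q_inj q_lt q_surj (fun s => W s (b s))).
  by split; apply: pow2 => s; have [_ _ _ /(_ (b s))[]] := hW s.
- move=> i; rewrite -card_bool -[X in (_ ^ X)%N]card_ord; split.
    apply: (@card_pred_family_le _ _ _ _ (fun a => a.2.1)) => b b'.
    rewrite !inE => /forallP bi /forallP b'i E; apply/ffunP => s.
    have [_ _ _ _ /(_ _ _ _ (q_lt i s) (E s))[+ _]] := hW s.
    exact.
  apply: (@card_pred_family_le _ _ _ _ (fun a => a.2.1)) => b b'.
  rewrite !inE => /forallP bi /forallP b'i E; apply/ffunP => s.
  have [_ _ _ _ /(_ _ _ _ (q_lt i s) (E s))[_ +]] := hW s.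
  exact.
- have labs i s : lab i s = D s (q i s) by rewrite ffunE.
  split.
  + move=> i j s /forallP /(_ s); rewrite labs => h.
    by have [_ /(_ _ _ (q_lt i s) (q_lt j s) h)[]] := hW s.
  + move=> i j s /forallP /(_ s); rewrite labs => h.
    by have [_ _ /(_ _ _ (q_lt i s) (q_lt j s) h)[]] := hW s.
  + move=> i j s /orP[/orP[]|].
    * move=> /forallP /(_ s); rewrite labs => h.
      by have [_ /(_ _ _ (q_lt i s) (q_lt j s) h)[_ /(congr1 val)]] := hW s.
    * move=> /forallP /(_ s); rewrite labs => h.
      by have [_ _ /(_ _ _ (q_lt i s) (q_lt j s) h)[_ /(congr1 val)]] := hW s.
    * move=> /eqP /ffunP /(_ s); rewrite !labs => E.
      have [h _ _ _ _] := hW s.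
      have := h _ (q_lt i s); rewrite E h // => /(congr1 val) /= ->.
      by [].
Qed.

(** The blocks are fixed before [g] and [xi], so the bound is uniform over the class and applies to
    an estimator that depends on the noise. *)
Lemma entirely_monotone_noise_bound (R : realType) (d : nat) (n : 'I_d -> nat)
    (N : nat) (x : 'I_N -> 'rV[R]_d) (p : 'I_d -> seq R) (f : 'rV[R]_d -> R) :
  (forall s, (1 <= n s)%N) -> N = (\prod_s n s)%N ->
  set_bij [set: 'I_N] (lattice n) x ->
  constant_on_cells p f ->
  exists (B : finType) (lab : 'I_N -> B) (q : 'I_N -> 'I_d -> 'I_N),
  (#|[pred b | [exists i, lab i == b]]| <=
     (\prod_s size (p s)) * (2 * (trunc_log 2 N).+1) ^ d)%N /\
  forall (g : 'rV[R]_d -> R) (xi : 'I_N -> R), entirely_monotone g ->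
  2 * (\sum_i xi i * (g (x i) - f (x i))) - \sum_i (g (x i) - f (x i)) ^+ 2 <=
  16 * (2 ^ d * 2 ^ d)%:R * \sum_b
    (\big[Num.max/0]_(j : {ffun 'I_d -> 'I_N})
      `|\sum_(i | (lab i == b) && [forall s, (j s <= q i s)%N]) xi i|) ^+ 2 /
    #|[pred i | lab i == b]|%:R.
Proof.
move=> n_gt0 NE xbij fp.
have [q [q_inj q_lt q_surj xE]] := lattice_enumeration n_gt0 NE xbij.
have [B [lab [up [down [cardB hcard hmul [hup hdown hcell]]]]]] :=
  dyadic_partition n_gt0 NE q_inj q_lt q_surj fp.
exists B, lab, (fun i s => q i s); split=> // g xi gEM.
pose S b := \big[Num.max/0]_(j : {ffun 'I_d -> 'I_N})
      `|\sum_(i | (lab i == b) && [forall s, (j s <= q i s)%N]) xi i|.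
pose pt (j : {ffun 'I_d -> 'I_N}) : 'rV[R]_d := grid_point R n (fun s => j s).
pose v i := g (x i) - f (x i).
have vE i : v i = g (pt (q i)) - f (pt (q i)) by rewrite /v xE.
have /boolp.choice[pq hpq] : forall b, exists pq : R * R,
    [/\ 0 <= pq.1 /\ forall i, up b i -> pq.1 <= `|v i|,
        0 <= pq.2 /\ forall i, down b i -> pq.2 <= `|v i| &
        `|\sum_(i | lab i == b) xi i * v i| <= (pq.1 + 2 * pq.2) * S b].
  move=> b; case: (pickP (fun i => lab i == b)) => [i0 bi0|b0]; last first.
    exists (0, 0); split => /=; [by split=> // i _|by split=> // i _|].
    by rewrite big_pred0 // normr0 mulr0 addr0 mul0r.
  (* The corners [l] and [r] take each extreme coordinate from its own point of the block. All these
     points share their cell indices, so [f] has one value on the block and at both corners. *)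
  have /boolp.choice[imin hmin] : forall s, exists i, lab i = b /\
      forall k, lab k = b -> (q i s <= q k s)%N.
    move=> s; case: (@arg_minnP _ i0 (fun i => lab i == b) (fun i => q i s) bi0).
    by move=> i /eqP li him; exists i; split=> // k /eqP; exact: him.
  have /boolp.choice[imax hmax] : forall s, exists i, lab i = b /\
      forall k, lab k = b -> (q k s <= q i s)%N.
    move=> s; case: (@arg_maxnP _ i0 (fun i => lab i == b) (fun i => q i s) bi0).
    by move=> i /eqP li him; exists i; split=> // k /eqP; exact: him.
  pose l : {ffun 'I_d -> 'I_N} := [ffun s => q (imin s) s].
  pose r : {ffun 'I_d -> 'I_N} := [ffun s => q (imax s) s].
  have l_le i s : lab i = b -> (l s <= q i s)%N.
    by rewrite ffunE; exact: (hmin s).2.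
  have le_r i s : lab i = b -> (q i s <= r s)%N.
    by rewrite ffunE; exact: (hmax s).2.
  have l_r s : (l s <= r s)%N.
    exact: leq_trans (l_le i0 s (eqP bi0)) (le_r _ _ (eqP bi0)).
  have l_lt s : (l s < n s)%N by rewrite ffunE.
  have r_lt s : (r s < n s)%N by rewrite ffunE.
  have f_r i : lab i = b -> f (pt (q i)) = f (pt r).
    move=> ib; apply: (cell_index_const n_gt0 fp) => // s.
    by rewrite [r s]ffunE; apply: hcell; rewrite ib (hmax s).1 eqxx orbT.
  have f_l i : lab i = b -> f (pt (q i)) = f (pt l).
    move=> ib; apply: (cell_index_const n_gt0 fp) => // s.
    by rewrite [l s]ffunE; apply: hcell; rewrite ib (hmin s).1 eqxx orbT.
  pose w := grid_increment n g l.
  pose v0 := g (pt l) - f (pt l).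
  pose W := \sum_(j : {ffun 'I_d -> 'I_N} |
        [forall s, (l s <= j s <= r s)%N] && (j != l)) w j.
  have w0 (j : {ffun 'I_d -> 'I_N}) :
      (forall s, (l s <= j s <= r s)%N) -> j != l -> 0 <= w j.
    move=> hj jl; apply: grid_increment_ge0 => // s.
      by have /andP[_ h] := hj s; exact: leq_ltn_trans h (r_lt s).
    by have /andP[] := hj s.
  have W0 : 0 <= W by apply: sumr_ge0 => j /andP[/forallP hj jl]; exact: w0.
  have vr : g (pt r) - f (pt r) = v0 + W.
    rewrite /pt (grid_increment_expansion n_gt0 g (i := r) l_r) -/(pt r) -/(pt l).
    by rewrite /v0 -(f_r i0) ?(f_l i0) ?(eqP bi0) // addrAC.
  have bound : `|\sum_(i | lab i == b) xi i * v i| <= (`|v0| + W) * S b.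
    apply: block_sum_bound w0 _ => i /eqP ib.
      by move=> s; rewrite l_le // le_r.
    rewrite vE /pt (grid_increment_expansion n_gt0 g (i := q i) (l := l)).
      by rewrite -/(pt (q i)) -/(pt l) f_l // /v0 addrAC.
    by move=> s; exact: l_le.
  have S0 : 0 <= S b by exact: bigmax_ge_id.
  (* The positive part at [r] and the negative part at [l]: monotonicity of [g] carries the first to
     [up b] and the second to [down b], where [f] is unchanged. *)
  exists (Num.max (v0 + W) 0, Num.max (- v0) 0); split => /=.
  - rewrite le_max lexx orbT; split=> // i ui.
    rewrite ge_max normr_ge0 andbT; apply: le_trans (ler_norm _).
    rewrite -vr vE.
    have -> : f (pt (q i)) = f (pt r).
      apply: (cell_index_const n_gt0 fp) => // s; rewrite [r s]ffunE.
      by apply/esym/hcell; rewrite (hmax s).1 ui.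
    rewrite lerD2r; apply: entirely_monotone_grid_le => // s.
    by rewrite ffunE; apply: hup; rewrite (hmax s).1.
  - rewrite le_max lexx orbT; split=> // i di.
    rewrite ge_max normr_ge0 andbT -normrN; apply: le_trans (ler_norm _).
    rewrite lerN2 vE.
    have -> : f (pt (q i)) = f (pt l).
      apply: (cell_index_const n_gt0 fp) => // s; rewrite [l s]ffunE.
      by apply/esym/hcell; rewrite (hmin s).1 di orbT.
    rewrite lerD2r; apply: entirely_monotone_grid_le => // s.
    by rewrite ffunE; apply: hdown; rewrite (hmin s).1.
  (* The absolute value of [v0] is [v0] plus twice its negative part, which explains the coefficient
     2. *)
  - apply: le_trans bound _; rewrite ler_wpM2r //.
    case: (lerP 0 (v0 + W)) => h1; case: (lerP 0 (- v0)) => h2;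
      case: (ger0P v0) => h3; lra.
apply: (blockwise_quadratic_bound (up := up) (down := down)
  (p := fun b => (pq b).1) (q := fun b => (pq b).2) (S := S)) => //.
- by rewrite muln_gt0 !expn_gt0.
- by move=> b; case: (hcard b).
- by move=> b; case: (hcard b).
- by move=> i; case: (hmul i).
- by move=> i; case: (hmul i).
- by move=> b; have [[]] := hpq b.
- by move=> b; have [[]] := hpq b.
- by move=> b; have [_ []] := hpq b.
- by move=> b; have [_ []] := hpq b.
- by move=> b; have [] := hpq b.
Qed.

(** * Convexity and least squares *)

Lemma entirely_monotone_convex (R : realType) (d : nat) (f g : 'rV[R]_d -> R)
    (t : R) :
  entirely_monotone f -> entirely_monotone g -> 0 <= t <= 1 ->
  entirely_monotone (fun z => f z + t * (g z - f z)).
Proof.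
move=> fEM gEM /andP[t0 t1] a b ha hb ab leab.
rewrite (_ : quasi_volume _ a b =
    (1 - t) * quasi_volume f a b + t * quasi_volume g a b).
  by rewrite addr_ge0 // mulr_ge0 ?subr_ge0 //; [exact: fEM|exact: gEM].
rewrite /quasi_volume !mulr_sumr -big_split; apply: eq_bigr => j _ /=.
by ring.
Qed.

(** The estimator is a projection onto a convex set. Comparison along the segment to [f] gives the
    first-order condition [A <= 0], and the two sides differ by [- (2 * A) / N]. *)
Lemma least_squares_pythagoras (R : realType) (d N : nat)
    (x : 'I_N -> 'rV[R]_d) (y xi : 'I_N -> R) (fstar fhat f : 'rV[R]_d -> R) :
  (0 < N)%N -> (forall i, y i = fstar (x i) + xi i) ->
  argmin (@entirely_monotone R d) (sq_error x y) fhat ->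
  entirely_monotone f ->
  loss x fhat fstar <= loss x f fstar + N%:R^-1 *
    (2 * (\sum_i xi i * (fhat (x i) - f (x i))) -
     \sum_i (fhat (x i) - f (x i)) ^+ 2).
Proof.
move=> N0 yE [hEM hmin] fEM.
have Ninv : 0 < N%:R^-1 :> R by rewrite invr_gt0 ltr0n.
pose A := \sum_i (y i - fhat (x i)) * (f (x i) - fhat (x i)).
pose H := \sum_i (f (x i) - fhat (x i)) ^+ 2.
have H0 : 0 <= H by apply: sumr_ge0 => i _; exact: sqr_ge0.
have var t : 0 <= t <= 1 -> 2 * t * A <= t ^+ 2 * H.
  move=> t01; have := hmin _ (entirely_monotone_convex hEM fEM t01).
  rewrite /sq_error ler_pM2l // -subr_ge0 -sumrB.
  rewrite (_ : \sum_i _ = t ^+ 2 * H - 2 * t * A); first by rewrite subr_ge0.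
  rewrite /H /A !mulr_sumr -sumrB; apply: eq_bigr => i _; ring.
have A0 : A <= 0.
  rewrite leNgt; apply/negP => A0.
  (* The step [t = A / (A + H)] stays within the segment even when [H = 0], and [var] would then
     give [2 * A <= t * H], which is less than [2 * A]. *)
  have AH : 0 < A + H by rewrite ltr_wpDr.
  have t0 : 0 < A / (A + H) by rewrite divr_gt0.
  have := var (A / (A + H)).
  rewrite (ltW t0) ler_pdivrMr // mul1r lerDl H0 => /(_ isT).
  rewrite mulrAC expr2 -[leRHS]mulrA [2 * _ * _]mulrC ler_pM2l //.
  rewrite mulrAC ler_pdivlMr //; nra.
rewrite /loss -mulrDr ler_wpM2l ?(ltW Ninv) //.
rewrite -subr_ge0 (_ : _ - _ = - (2 * A)); first by rewrite oppr_ge0; nra.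
rewrite /A mulr_sumr [in 2 * _]mulr_sumr -sumrB -big_split -sumrB -sumrN.
by apply: eq_bigr => i _ /=; rewrite yE; ring.
Qed.

(** * The risk bound *)

Lemma ln_expR1M_ge1 (R : realType) (x : R) : 1 <= x -> 1 <= ln (expR 1 * x).
Proof.
move=> x1; have x0 : 0 < x by exact: lt_le_trans x1.
by rewrite lnM ?posrE ?expR_gt0 // expRK lerDl ln_ge0.
Qed.

Lemma trunc_log_le_ln (R : realType) (N : nat) : (0 < N)%N ->
  (trunc_log 2 N).+1%:R <= (1 + (ln 2)^-1) * ln (expR 1 * N%:R) :> R.
Proof.
move=> N0; have ln2 : 0 < ln 2 :> R by rewrite ln_gt0 // ltr1n.
rewrite lnM ?posrE ?expR_gt0 ?ltr0n // expRK.
have lnN : 0 <= ln N%:R :> R by rewrite ln_ge0 // ler1n.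
have : (trunc_log 2 N)%:R <= (ln 2)^-1 * ln N%:R :> R.
  rewrite ler_pdivlMl // mulr_natr -lnXn //.
  rewrite ler_ln ?posrE ?exprn_gt0 ?ltr0n //.
  by rewrite -natrX ler_nat trunc_logP.
have := invr_gt0 (ln 2 : R); rewrite ln2 -natr1 => i2.
move: (ln N%:R) lnN (ln 2)^-1 i2 => a a0 b b0; nra.
Qed.

(** Both logarithms are at least 1, so the exponent [d] may grow to [3 * d / 2], and the iterated
    logarithm with its nonnegative exponent may be inserted. *)
Lemma dyadic_count_le_log_factor (R : realType) (d N : nat) :
  (1 <= d)%N -> (0 < N)%N ->
  ((2 * (trunc_log 2 N).+1) ^ d)%:R <=
  (2 * (1 + (ln 2)^-1)) ^+ d * (ln (expR 1 * N%:R) `^ ((3 * d)%:R / 2) *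
    ln (expR 1 * ln (expR 1 * N%:R)) `^ (((2 * d)%:R - 1) / 2)) :> R.
Proof.
move=> d1 N0.
have L1 : 1 <= ln (expR 1 * N%:R) :> R by apply: ln_expR1M_ge1; rewrite ler1n.
have LL1 := ln_expR1M_ge1 L1.
set L := ln (expR 1 * N%:R) in L1 LL1 *.
have L0 : 0 <= L by exact: le_trans L1.
apply: (@le_trans _ _ ((2 * (1 + (ln 2)^-1)) ^+ d * L ^+ d)).
  rewrite natrX -exprMn lerXn2r ?nnegrE //.
    by rewrite !mulr_ge0 // addr_ge0 // invr_ge0 ln_ge0 // ler1n.
  by rewrite natrM -mulrA ler_wpM2l // trunc_log_le_ln.
rewrite ler_wpM2l ?exprn_ge0 ?mulr_ge0 ?addr_ge0 ?invr_ge0 ?ln_ge0 ?ler1n //.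
rewrite -[leLHS]mulr1 ler_pM ?exprn_ge0 //.
  rewrite -powR_mulrn // ler_powR //.
  by rewrite natrM; have : 0 <= d%:R :> R by []; lra.
rewrite -[leLHS](powRr0 (ln (expR 1 * L))) ler_powR //.
have : 1 <= d%:R :> R by rewrite ler1n.
by rewrite natrM; lra.
Qed.

Lemma min_cells_attained (R : realType) (d : nat) (f : 'rV[R]_d -> R) :
  rect_pw_constant f ->
  exists2 p, constant_on_cells p f & min_cells f = (\prod_s size (p s))%N.
Proof.
move=> [p0 fp0].
pose P : pred nat := fun m => boolp.asbool (cell_counts f m).
have exP : exists m, P m.
  by exists (\prod_s size (p0 s))%N; apply/boolp.asboolP; exists p0.
have [] : [set m | cell_counts f m /\
    forall m', cell_counts f m' -> (m <= m')%N] (min_cells f); last by [].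
apply: xgetPex; case: (ex_minnP exP) => m /boolp.asboolP fm hm.
by exists m; split=> // m' fm'; apply: hm; exact/boolp.asboolP.
Qed.

(** In expectation the squared maximum of a block is of the order of its size, which cancels the
    division by that size. Every block that occurs costs the same [C], so only the number of blocks
    matters. *)
Lemma risk_entirely_monotone_le (R : realType) (d : nat) (n : 'I_d -> nat)
    (N : nat) (x : 'I_N -> 'rV[R]_d) (sigma : R) (fstar : 'rV[R]_d -> R)
    (disp : measure_display) (T : measurableType disp) (P : probability T R)
    (xi : 'I_N -> {RV P >-> R}) (y : 'I_N -> T -> R)
    (fhat : T -> 'rV[R]_d -> R) (p : 'I_d -> seq R) (f : 'rV[R]_d -> R) :
  (forall s, (1 <= n s)%N) -> N = (\prod_s n s)%N ->
  set_bij [set: 'I_N] (lattice n) x -> 0 < sigma -> iid_normal 0 sigma xi ->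
  (forall i w, y i w = fstar (x i) + xi i w) ->
  (forall w, argmin (@entirely_monotone R d)
     (sq_error x (fun i => y i w)) (fhat w)) ->
  constant_on_cells p f -> entirely_monotone f ->
  (risk P x fhat fstar <= (loss x f fstar +
    N%:R^-1 * (16 * (2 ^ d * 2 ^ d)%:R * (4 ^+ d * (8 * sigma ^+ 2)) *
    ((\prod_s size (p s)) * (2 * (trunc_log 2 N).+1) ^ d)%:R))%:E)%E.
Proof.
move=> n_gt0 NE xbij sigma0 hxi yE hfhat fp fEM.
have N0 : (0 < N)%N by rewrite NE prodn_cond_gt0.
have [B [lab [q [cardB noise]]]] := entirely_monotone_noise_bound n_gt0 NE xbij fp.
pose S b w := (\big[Num.max/0]_(j : {ffun 'I_d -> 'I_N})
  `|\sum_(i | (lab i == b) && [forall s, (j s <= q i s)%N]) xi i w|) ^+ 2.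
pose a : R := N%:R^-1 * (16 * (2 ^ d * 2 ^ d)%:R).
have a0 : 0 <= a by rewrite !mulr_ge0 ?invr_ge0.
pose m b : R := #|[pred i | lab i == b]|%:R.
have m0 b : 0 <= (m b)^-1 by rewrite invr_ge0.
have loss0 g : 0 <= loss x g fstar.
  by rewrite mulr_ge0 ?invr_ge0 // sumr_ge0 // => i _; exact: sqr_ge0.
have S0 b w : 0 <= S b w by exact: sqr_ge0.
have mS b : measurable_fun setT (S b).
  apply: measurable_funX; apply: measurable_bigmax => j.
  by apply: measurableT_comp => //; apply: measurable_sum_cond.
rewrite /risk unlock.
apply: (@le_trans _ _ (\int[P]_w ((loss x f fstar)%:E +
    \sum_b (a / m b * S b w)%:E))%E).
  apply: ge0_le_integral_pointwise => w; first by rewrite lee_fin.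
  rewrite sumEFin -EFinD lee_fin.
  apply: le_trans (least_squares_pythagoras N0 (fun i => yE i w) (hfhat w) fEM) _.
  rewrite lerD2l; have [hEM _] := hfhat w.
  under [leRHS]eq_bigr do rewrite -mulrA [_^-1 * _]mulrC.
  rewrite -mulr_sumr /a -mulrA ler_wpM2l ?invr_ge0 //.
  exact: (noise (fhat w) (fun i => xi i w)).
rewrite ge0_integralD //; last 3 first.
- by move=> w _; rewrite lee_fin.
- by move=> w _; apply: sume_ge0 => b _; rewrite lee_fin mulr_ge0 ?S0 // mulr_ge0.
- apply: emeasurable_sum => b; apply/measurable_EFinP.
  exact: measurable_funM.
have -> : (\int[P]_w (loss x f fstar)%:E = (loss x f fstar)%:E)%E.
  rewrite integral_cst // -[RHS]mule1; congr (_ * _)%E.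
  exact: probability_setT.
rewrite EFinD leeD2lE //.
rewrite ge0_integral_sum //; last 2 first.
- by move=> b; apply/measurable_EFinP; exact: measurable_funM.
- by move=> b w _; rewrite lee_fin mulr_ge0 ?S0 // mulr_ge0.
pose C := a * (4 ^+ d * (8 * sigma ^+ 2)).
have C0 : 0 <= C.
  by rewrite /C mulr_ge0 // mulr_ge0 ?exprn_ge0 // mulr_ge0 ?sqr_ge0.
apply: (@le_trans _ _ (\sum_(b | [exists i, lab i == b]) C%:E)%E).
  rewrite [leRHS]big_mkcond /=; apply: lee_sum => b _.
  under eq_integral do rewrite EFinM.
  rewrite ge0_integralZl //; last 3 first.
  - exact/measurable_EFinP.
  - by move=> w _; rewrite lee_fin.
  - by rewrite lee_fin mulr_ge0 ?m0.
  have hb := expected_maximal_ineq sigma0 hxi q (fun i => lab i == b).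
  (* A label that does not occur has [m b = 0], so its coefficient [a / m b] is 0. *)
  case: ifPn => [/existsP[i ib]|]; last first.
    rewrite negb_exists => /forallP nb.
    have -> : m b = 0 by rewrite /m eq_card0 // => i; rewrite inE (negbTE (nb i)).
    by rewrite invr0 mulr0 mul0e.
  have mb : 0 < m b.
    by rewrite ltr0n; apply/card_gt0P; exists i; rewrite inE.
  apply: le_trans (lee_wpmul2l _ hb) _; first by rewrite lee_fin mulr_ge0 ?m0.
  rewrite -EFinM lee_fin le_eqVlt /C; apply/orP; left; apply/eqP.
  by rewrite -/(m b); field; rewrite gt_eqF.
rewrite sumEFin lee_fin sumr_const -[leLHS]mulr_natr.
rewrite (_ : N%:R^-1 * _ = C * ((\prod_s size (p s)) *
  (2 * (trunc_log 2 N).+1) ^ d)%:R); last by rewrite /C /a !mulrA.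
by rewrite ler_wpM2l // ler_nat.
Qed.

Unset Implicit Arguments.

Theorem theorem4p4 (R : realType) (d : nat) (hd : (1 <= d)%N) :
  exists C : R,
  forall (n : 'I_d -> nat) (hn : forall j, (1 <= n j)%N)
    (N : nat) (hN : N = (\prod_j n j)%N)
    (x : 'I_N -> 'rV[R]_d) (hx : set_bij [set: 'I_N] (lattice n) x)
    (sigma : R) (hsigma : 0 < sigma)
    (fstar : 'rV[R]_d -> R)
    (disp : measure_display) (T : measurableType disp) (P : probability T R)
    (xi : 'I_N -> {RV P >-> R}) (hxi : iid_normal 0 sigma xi)
    (y : 'I_N -> T -> R) (hy : forall i w, y i w = fstar (x i) + xi i w)
    (fhat : T -> 'rV[R]_d -> R)
    (hfhat : forall w, argmin (@entirely_monotone R d)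
                         (sq_error x (fun i => y i w)) (fhat w)),
  (risk P x fhat fstar <=
   ereal_inf
     [set (loss x f fstar
           + C * sigma ^+ 2 * ((min_cells f)%:R / N%:R)
             * ln (expR 1 * N%:R) `^ ((3 * d)%:R / 2)
             * ln (expR 1 * ln (expR 1 * N%:R)) `^ (((2 * d)%:R - 1) / 2))%:E
     | f in @rect_pw_constant R d `&` @entirely_monotone R d])%E.
Proof.
(* The first factor comes from absorbing the quadratic term, with [2 ^ d] for block sizes and
   [2 ^ d] for overlaps; the second from the maximal inequality and the moment bound
   [8 * sigma ^+ 2]. The remaining factor of the witness converts binary into natural logarithms. *)
pose C0 : R := 16 * (2 ^ d * 2 ^ d)%:R * (4 ^+ d * 8).
exists (C0 * (2 * (1 + (ln 2)^-1)) ^+ d).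
move=> n hn N hN x hx sigma hsigma fstar disp T P xi hxi y hy fhat hfhat.
apply/ereal_infP => _ [f [frect fEM] <-].
have [p fp ->] := min_cells_attained frect.
have N0 : (0 < N)%N by rewrite hN prodn_cond_gt0.
apply: le_trans (risk_entirely_monotone_le hn hN hx hsigma hxi hy hfhat fp fEM) _.
rewrite lee_fin lerD2l; set k := (\prod_s size (p s))%N.
have := dyadic_count_le_log_factor R hd N0.
set D := ((2 * _) ^ d)%N; set F := _ `^ _; set G := _ `^ _ => DFG.
have pos : 0 <= N%:R^-1 * C0 * sigma ^+ 2 * k%:R.
  have C00 : 0 <= C0 by rewrite /C0 mulr_ge0 // mulr_ge0 // exprn_ge0.
  by rewrite mulr_ge0 // mulr_ge0 ?sqr_ge0 // mulr_ge0 ?invr_ge0.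
rewrite [leLHS](_ : _ = N%:R^-1 * C0 * sigma ^+ 2 * k%:R * D%:R); last first.
  by rewrite natrM /C0; ring.
apply: le_trans (ler_wpM2l pos DFG) _.
by rewrite le_eqVlt; apply/orP; left; apply/eqP; ring.
Qed.
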